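(* Let $\Gamma$ be a countable group. Every factor of iid thinning of $\Gamma$ is a weak-* limit of unimodular random subsets of $\Gamma$ supported on finite subsets of $\Gamma$.
   Context: $\mathcal M(\Gamma)$ denotes the space of non-empty subsets of $\Gamma$ and $\mathcal M_o(\Gamma)$ the space of subsets containing the identity, with the product topology. The re-rooting equivalence relation on $\mathcal M_o(\Gamma)$ is $E\sim\gamma^{-1}E$ for $\gamma\in E$. A unimodular random subset is a probability measure on $\mathcal M_o(\Gamma)$ invariant under the re-rooting relation. For a measure preserving action $\Gamma\curvearrowright(Y,\nu)$ and a measurable $U\subset Y$ of finite positive measure, let $\iota_U(y)=\{\gamma\in\Gamma\mid\gamma^{-1}y\in U\}$ and $\mathcal F(Y,U):=\nu(U)^{-1}(\iota_U)_*(\nu|_U)$, a unimodular random subset. A thinning of a probability measure preserving action $(X,\mu)$ is a weak-* limit of $\mathcal F(X,U_n)$ with $\mu(U_n)\to0$. A factor of iid thinning is a thinning of the Bernoulli shift $([0,1]^\Gamma,\mathrm{Leb}^\Gamma)$. *)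

(* Defs.v *)
From HB Require Import structures.
From mathcomp Require Import all_boot all_order all_algebra.
From mathcomp Require Import all_classical all_reals all_analysis.

Set Implicit Arguments.
Unset Strict Implicit.
Unset Printing Implicit Defensive.

Import Order.TTheory GRing.Theory Num.Theory.
Import numFieldTopology.Exports.

Local Open Scope classical_set_scope.
Local Open Scope ring_scope.

#[short(type="countGroupType")]
HB.structure Definition CountGroup := {G of monoid.Group G & Countable G}.

Section Defs.
Variables (R : realType) (G : countGroupType).

Local Notation gmul := (@monoid.mul G).
Local Notation ginv := (@monoid.inv G).
Local Notation gone := (@monoid.one G).

(* A subset E of Gamma is encoded by its indicator E : G -> bool.
   Topologically, {ptws G -> bool} is 2^Gamma with the product topology.
   Measurably, it carries the sigma-algebra generated by the cylinders
   {E | g \in E}, which is the Borel sigma-algebra of the product topology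
   since G is countable. *)
Definition cylinders : set (set (G -> bool)) :=
  [set [set E : G -> bool | E g] | g in [set: G]].

Definition subsetsM := g_sigma_algebraType cylinders.

Definition Mo : set subsetsM := [set E : subsetsM | E gone].

Definition weak_cvg (Pn : nat -> probability subsetsM R)
    (P : probability subsetsM R) : Prop :=
  forall f : {ptws G -> bool} -> R, continuous f ->
    (fun n => (\int[Pn n]_E (f E)%:E)%E) @ \oo --> (\int[P]_E (f E)%:E)%E.

(* Unimodular random subset: a probability measure on M_o(Gamma) (i.e. a
   probability on M(Gamma) giving full mass to M_o(Gamma)) invariant under the
   re-rooting equivalence relation E ~ g^-1 E (g \in E).  Invariance is
   expressed as: each partial bijection theta_g : {E | g \in E} -> {F | g^-1 \in F},
   E |-> g^-1 E, (these generate the relation) preserves the measure, i.e.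
   P (theta_g^-1 B) = P (B \cap range theta_g) for all measurable B.
   Note  h \in g^-1 E  <->  g * h \in E. *)
Definition unimodular (P : probability subsetsM R) : Prop :=
  P Mo = 1%E /\
  forall (g : G) (B : set subsetsM), measurable B ->
    P [set E : subsetsM | E g /\ B (fun h => E (gmul g h))] = P [set E : subsetsM | E (ginv g) /\ B E].

Definition finitely_supported (P : probability subsetsM R) : Prop :=
  P [set E : subsetsM | finite_set [set g | E g]] = 1%E.

Section Thinning.
Variables (d : measure_display) (X : measurableType d) (act : G -> X -> X).

Definition iotaU (U : set X) (y : X) : subsetsM := fun g => `[< U (act (ginv g) y) >].

(* nu = F(X, U) = mu(U)^-1 (iota_U)_* (mu|_U), stated on measurable sets *)
Definition is_F (mu : probability X R) (U : set X)
    (nu : probability subsetsM R) : Prop :=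
  forall A : set subsetsM, measurable A ->
    (mu U * nu A = mu (U `&` iotaU U @^-1` A))%E.

Definition thinning (mu : probability X R) (nu : probability subsetsM R) : Prop :=
  exists (U : nat -> set X) (Fn : nat -> probability subsetsM R),
    (forall n, [/\ measurable (U n), (0 < mu (U n))%E & is_F mu (U n) (Fn n)]) /\
    (fun n => mu (U n)) @ \oo --> 0%E /\
    weak_cvg Fn nu.
End Thinning.

(* Realised on R^Gamma with the product sigma-algebra generated by the
   coordinate maps; Leb^Gamma is characterised by its finite-dimensional
   marginals (product of Lebesgue measure restricted to [0,1]); this
   determines the measure uniquely (pi-lambda) and forces full mass on [0,1]^Gamma. *)
Definition coord_cylinders : set (set (G -> R)) :=
  [set A | exists (g : G) (B : set R), measurable B /\ A = [set x | B (x g)]].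

Definition bshift_space := g_sigma_algebraType coord_cylinders.

Definition iid_uniform (mu : probability bshift_space R) : Prop :=
  forall (s : seq G) (B : G -> set R), uniq s -> (forall g, measurable (B g)) ->
    mu [set x | forall g, g \in s -> B g (x g)] =
    (\prod_(g <- s) lebesgue_measure (B g `&` `[0%R, 1%R]))%E.

Definition bshift (g : G) (x : bshift_space) : bshift_space := fun h => x (gmul (ginv g) h).

Definition fiid_thinning (nu : probability subsetsM R) : Prop :=
  exists mu : probability bshift_space R, iid_uniform mu /\ thinning bshift mu nu.

End Defs.

(* Main.v *)
Require Import Defs.
From HB Require Import structures.
From mathcomp Require Import all_boot all_order all_algebra.
From mathcomp Require Import all_classical all_reals all_analysis.
From mathcomp Require Import measurable_realfun finmap ring lra zify.

(** Let U be an event of small probability p in the Bernoulli shift; up to a small error it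
    depends on finitely many binary digits of the labels. Reveal these digits in the order of iid
    random times attached to them, and let eps_i be the relative bias that digit i, when it is
    revealed, has under the conditional law given U. On U the energy, i.e. the sum of the eps_i^2,
    is almost always large: the mean over U of the product of the (1 + eps_i^2)^-1 equals p. On the
    other hand, if V is a translate of U, the sum of the (eps_i(U) - eps_i(V))^2 over U cap V has
    bounded mean, because each digit pays for its squared difference by the gap in the
    Cauchy-Schwarz inequality between the conditional masses of U cap V and U (or V). Hence the
    weights eps_i^2 / energy, a probability vector on the digits, barely change when U is replaced
    by a translate.

    Every point of the random set { g : g^-1 y in U } thus spreads a unit mass over digits near it,
    and neighbouring points spread almost the same mass. Cutting the mass at a digit into
    N levels and collecting the points that use a given level of a given digit yields finite
    clusters; the uniformly chosen cluster is unimodular by mass transport, and since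
    neighbouring points mostly belong to the same clusters, its local patterns are close to those of
    F(X, U). *)

Set Implicit Arguments.
Unset Strict Implicit.
Unset Printing Implicit Defensive.

Import Order.TTheory GRing.Theory Num.Theory.
Import numFieldTopology.Exports.

Local Open Scope ring_scope.

(** * Biases along a revelation order *)

Section Cube.
Variables (R : rcfType) (I : finType).
Implicit Types (P Q : pred I) (x y : {ffun I -> bool}) (u w : {ffun I -> bool} -> R).

(** The order of revelation is random for the sake of equivariance: sites need not carry an order
    invariant under the group, while times that belong to the labels move with them. Discretized
    times keep every sum finite; ties are made rare and are paid for by a trivial bound. The
    smallness of [U] is what makes the weights stable. Given [U], the energy is at most [B] with
    probability at most [expR B * p], so a small [p] permits a large [B]; and normalized squares of
    two vectors at bounded distance are close in the [l^1] norm once one of the squared norms is at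
    least [B]. The number of digits on which the approximation of [U] depends is beyond control.
    Hence the energy and difference estimates must not depend on it, and the bound on [p] may depend
    only on the tested pattern and the tolerance; the numbers of times and of levels are chosen
    last, when the digits are known. Levels are used, rather than an independent choice by each
    point, because two points that send nearly the same mass to a digit must mostly end up in the
    same cluster. *)

Definition face (A : eqType) P (x y : {ffun I -> A}) := [forall i, P i || (y i == x i)].

Definition upd x i b : {ffun I -> bool} := [ffun j => if j == i then b else x j].

Lemma faceP (A : eqType) P (x y : {ffun I -> A}) :
  reflect (forall i, ~~ P i -> y i = x i) (face P x y).
Proof.
apply: (iffP forallP) => [h i Pi|h i].
  by have := h i; rewrite (negbTE Pi) => /eqP.
by case: (boolP (P i)) => //= /h ->.
Qed.

Lemma eq_face (A : eqType) P Q : P =1 Q -> @face A P =2 @face A Q.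
Proof. by move=> PQ x y; apply: eq_forallb => i; rewrite PQ. Qed.

Lemma face_split P Q i x y : ~~ Q i -> P =1 [pred j | (j == i) || Q j] ->
  face P x y = face Q (upd x i (y i)) y.
Proof.
move=> Qi PQ; apply/faceP/faceP => h j.
  move=> Qj; rewrite ffunE; case: eqVneq => [->//|ji].
  by apply: h; rewrite PQ /= (negbTE ji).
rewrite PQ /= negb_or => /andP[ji Qj].
by rewrite (h j) // ffunE (negbTE ji).
Qed.

Lemma sum_face_split (V : nmodType) P Q i x (F : {ffun I -> bool} -> V) :
  ~~ Q i -> P =1 [pred j | (j == i) || Q j] ->
  \sum_(y | face P x y) F y =
  \sum_(y | face Q (upd x i true) y) F y + \sum_(y | face Q (upd x i false) y) F y.
Proof.
move=> Qi PQ.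
rewrite (bigID (fun y : {ffun I -> bool} => y i)) /=.
have E b y : face P x y && (y i == b) = face Q (upd x i b) y.
  rewrite (face_split _ _ Qi PQ); apply/andP/idP => [[h /eqP <-]//|h].
  have yi : y i = b by rewrite (faceP _ _ _ h) // ffunE eqxx.
  by rewrite yi.
by congr (_ + _); apply: eq_bigl => y; rewrite -E; case: (y i).
Qed.

(** Under the uniform measure this is an unnormalized conditional expectation given the digits
    outside [P]; the missing factor cancels in every bias. *)
Definition mass u P x : R := \sum_(y | face P x y) u y.

Definition later (tau : I -> nat) i : pred I := [pred j | tau i < tau j]%N.

(** The digits are revealed by increasing [tau]: given the digits up to [i], the later ones are
    averaged out. The bias is [0 / 0 = 0] when no continuation meets the event. *)
Definition bias u tau i x : R :=
  (mass u (later tau i) (upd x i true) - mass u (later tau i) (upd x i false)) /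
  (mass u (later tau i) (upd x i true) + mass u (later tau i) (upd x i false)).

(** Previsibility, which lets a bias be pulled out of a sum over the digits still hidden. *)
Lemma eq_bias u tau i x y : face [pred j | (j == i) || later tau i j] x y ->
  bias u tau i y = bias u tau i x.
Proof.
move=> /faceP xy; rewrite /bias /mass.
suff e b : face (later tau i) (upd y i b) =1 face (later tau i) (upd x i b).
  by rewrite !(eq_bigl _ _ (e _)).
move=> z; apply/faceP/faceP => h j lj; rewrite (h _ lj) !ffunE.
  by case: eqVneq => // ji; rewrite xy //= (negbTE ji).
by case: eqVneq => // ji; rewrite xy //= (negbTE ji).
Qed.

Section Chain.
Variable tau : I -> nat.

(** [l] lists the digits still hidden, earliest first. Inductions on [l] therefore run backwards in
    time, and strict sorting excludes ties. *)
Definition upper (l : seq I) :=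
  sorted (fun i j => tau i < tau j)%N l /\
  forall i j, i \in l -> (tau i < tau j)%N -> j \in l.

Lemma upper_cons i l : upper (i :: l) ->
  [/\ upper l, i \notin l & later tau i =1 mem l].
Proof.
move=> [sl ul].
have tr : transitive (fun i j => tau i < tau j)%N by move=> a b c /=; apply: ltn_trans.
have /allP il : all (fun j => tau i < tau j)%N l by exact: order_path_min tr sl.
have nil : i \notin l by apply/negP => /il /=; rewrite ltnn.
have lE : later tau i =1 mem l.
  move=> j; apply/idP/idP => [ij|/il//].
  have := ul i j (mem_head _ _) ij; rewrite inE => /orP[/eqP e|//].
  by move: ij; rewrite e /later /= ltnn.
split=> //; split; first exact: path_sorted sl.
move=> a b al' ab; have := ul a b; rewrite !inE al' orbT => /(_ isT ab) /orP[/eqP e|//].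
by move: ab; rewrite e ltnNge ltnW // il.
Qed.

Lemma mass_split u l i x : upper (i :: l) ->
  mass u (mem (i :: l)) x =
  mass u (later tau i) (upd x i true) + mass u (later tau i) (upd x i false).
Proof.
move=> /upper_cons[_ il lE]; apply: sum_face_split => [|j]; first by rewrite lE.
by rewrite /= lE inE.
Qed.

Lemma mass_ge0 u P x : (forall y, 0 <= u y) -> 0 <= mass u P x.
Proof. by move=> u0; apply: sumr_ge0. Qed.

(** The factor [2 * (a ^+ 2 + b ^+ 2) / (a + b) ^+ 2] is one plus the chi-square divergence of the
    two-point law with masses [a], [b] from a fair coin. If [a + b = 0], both sides vanish. *)
Lemma two_point_chi2 (a b : R) : 0 <= a -> 0 <= b ->
  (1 + ((a - b) / (a + b)) ^+ 2)^-1 * (a ^+ 2 + b ^+ 2) = (a + b) ^+ 2 / 2.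
Proof.
move=> a0 b0; have [ab0|ab0] := eqVneq (a + b) 0.
  have -> : a = 0 by lra.
  have -> : b = 0 by lra.
  by rewrite !addr0 !expr0n /= addr0 mulr0 mul0r.
have ab2 : a ^+ 2 + b ^+ 2 != 0.
  apply: contra_neq ab0 => h.
  have a2 := sqr_ge0 a; have b2 := sqr_ge0 b.
  have /eqP : a ^+ 2 = 0 by lra.
  have /eqP : b ^+ 2 = 0 by lra.
  by rewrite !sqrf_eq0 => /eqP -> /eqP ->; rewrite addr0.
have -> : 1 + ((a - b) / (a + b)) ^+ 2 = 2 * (a ^+ 2 + b ^+ 2) / (a + b) ^+ 2 by field.
by field; rewrite ab0 ab2.
Qed.

Lemma bias_face u l i x y : upper (i :: l) -> face (mem (i :: l)) x y ->
  bias u tau i y = bias u tau i x.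
Proof.
move=> /upper_cons[_ _ lE] h; apply: eq_bias; rewrite -(eq_face (P := mem (i :: l))) //.
by move=> j /=; rewrite lE inE.
Qed.

(** Revealing the earliest hidden digit splits the mass into [a + b]. Its bias is constant on the
    face, the halves contribute [a ^+ 2] and [b ^+ 2] by induction, and the chi-square factor turns
    their sum into [(a + b) ^+ 2 / 2]. The base case is [u = u ^+ 2] for an indicator. *)
Lemma sum_prod_bias u l x : (forall y, u y = 0 \/ u y = 1) -> upper l ->
  \sum_(y | face (mem l) x y) u y * \prod_(i <- l) (1 + bias u tau i y ^+ 2)^-1
  = mass u (mem l) x ^+ 2 / 2 ^+ size l.
Proof.
move=> u01; have u0 y : 0 <= u y by case: (u01 y) => ->.
elim: l x => [|i l IH] x ul.
  rewrite /mass expr0 divr1.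
  have E y : face (mem [::]) x y = (y == x).
    by apply/faceP/eqP => [h|->//]; apply/ffunP => i; apply: h.
  rewrite !(eq_bigl _ _ E) !big_pred1_eq big_nil.
  by case: (u01 x) => ->; rewrite ?(mul0r, mulr1, expr0n, expr1n).
have [ul' il lE] := upper_cons ul.
rewrite (eq_bigr (fun y => (1 + bias u tau i x ^+ 2)^-1 *
   (u y * \prod_(j <- l) (1 + bias u tau j y ^+ 2)^-1))); last first.
  by move=> y xy; rewrite big_cons (bias_face _ ul xy) mulrCA.
rewrite -mulr_sumr (@sum_face_split _ _ (mem l) i) //.
rewrite !IH // (mass_split _ _ ul) /bias.
have mE z : mass u (mem l) z = mass u (later tau i) z.
  by apply: eq_bigl => y; apply: eq_face.
rewrite !mE; set a := mass _ _ _; set b := mass _ _ _.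
have := @two_point_chi2 a b (mass_ge0 _ _ u0) (mass_ge0 _ _ u0).
rewrite -mulrDl mulrA => ->.
by rewrite [size (i :: l)]/= (exprS 2) invfM mulrA.
Qed.

(** The gap [8 (a b - (a1 b1 + a0 b0))] in Cauchy-Schwarz controls the squared difference [d] of the
    biases of the two-point masses [a_i ^ 2] and [b_i ^ 2]. *)
Lemma cauchy_schwarz_gap (a1 a0 b1 b0 a b d : R) :
  0 <= a1 -> 0 <= a0 -> 0 <= b1 -> 0 <= b0 -> 0 < a -> 0 < b ->
  a ^+ 2 = a1 ^+ 2 + a0 ^+ 2 -> b ^+ 2 = b1 ^+ 2 + b0 ^+ 2 -> a ^+ 2 <= b ^+ 2 ->
  d * (b ^+ 2 * a ^+ 2) = 2 * (b1 ^+ 2 * a0 ^+ 2 - b0 ^+ 2 * a1 ^+ 2) ->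
  a ^+ 2 * d ^+ 2 + 8 * (a1 * b1 + a0 * b0) <= 8 * (a * b).
Proof.
move=> a10 a00 b10 b00 ap bp a2 b2 ab2 dE.
have abab : a <= b by rewrite -(@ler_pXn2r _ 2) // nnegrE ltW.
(* [m] is the inner product and [D] the determinant of the two vectors, and [mD] is Lagrange's
   identity. The gap [a * b - m] equals [D ^+ 2 / (a * b + m)], hence is at least
   [D ^+ 2 / (2 * (a * b))]. *)
pose m := a1 * b1 + a0 * b0; pose D := a1 * b0 - a0 * b1.
have mD : (a * b) ^+ 2 = m ^+ 2 + D ^+ 2 by rewrite exprMn a2 b2 /m /D; ring.
have m0 : 0 <= m by rewrite /m addr_ge0 ?mulr_ge0.
have abp : 0 < a * b by exact: mulr_gt0.
have mab : m <= a * b.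
  rewrite -(@ler_pXn2r _ 2) ?nnegrE ?(ltW abp) // mD; have := sqr_ge0 D; lra.
have dD : (d * (a * b) ^+ 2) ^+ 2 <= 4 * D ^+ 2 * (a * b) ^+ 2.
  have -> : d * (a * b) ^+ 2 = 2 * (b1 ^+ 2 * a0 ^+ 2 - b0 ^+ 2 * a1 ^+ 2).
    by rewrite exprMn -dE; ring.
  have -> : (2 * (b1 ^+ 2 * a0 ^+ 2 - b0 ^+ 2 * a1 ^+ 2)) ^+ 2 =
      4 * D ^+ 2 * (a1 * b0 + a0 * b1) ^+ 2 by rewrite /D; ring.
  apply: ler_wpM2l; first by rewrite mulr_ge0 // sqr_ge0.
  rewrite exprMn a2 b2 -subr_ge0.
  have -> : (a1 ^+ 2 + a0 ^+ 2) * (b1 ^+ 2 + b0 ^+ 2) - (a1 * b0 + a0 * b1) ^+ 2 =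
    (a1 * b1 - a0 * b0) ^+ 2 by ring.
  exact: sqr_ge0.
have dD2 : d ^+ 2 * (a * b) ^+ 2 <= 4 * D ^+ 2.
  rewrite -(ler_pM2r (exprn_gt0 2 abp)).
  by apply: le_trans dD; rewrite le_eqVlt; apply/orP; left; apply/eqP; ring.
have D2 : D ^+ 2 <= 2 * (a * b) * (a * b - m).
  have -> : D ^+ 2 = (a * b - m) * (a * b + m) by have := mD; lra.
  rewrite [leRHS]mulrC; apply: ler_wpM2l; lra.
have h1 : d ^+ 2 * (a * b) <= 8 * (a * b - m).
  rewrite -(ler_pM2r abp) -mulrA -expr2; apply: le_trans dD2 _; lra.
have h2 : d ^+ 2 * a ^+ 2 <= d ^+ 2 * (a * b).
  by rewrite ler_wpM2l ?sqr_ge0 // expr2 ler_wpM2l // ltW.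
rewrite /m in h1; lra.
Qed.

(** The gap inequality for the square roots of the masses. [Num.sqrt (w * u)] acts as a Hellinger
    affinity: its drop when one digit is revealed pays for the squared difference of the biases. *)
Lemma two_point_bias (u1 u0 w1 w0 : R) : 0 <= w1 <= u1 -> 0 <= w0 <= u0 ->
  (w1 + w0) * ((u1 - u0) / (u1 + u0) - (w1 - w0) / (w1 + w0)) ^+ 2
  + 8 * (Num.sqrt (w1 * u1) + Num.sqrt (w0 * u0))
  <= 8 * Num.sqrt ((w1 + w0) * (u1 + u0)).
Proof.
move=> /andP[w1p w1u] /andP[w0p w0u].
have [wz|wz] := eqVneq (w1 + w0) 0.
  have -> : w1 = 0 by lra.
  have -> : w0 = 0 by lra.
  by rewrite !(addr0, mul0r, sqrtr0, mulr0).
have wp : 0 < w1 + w0 by rewrite lt_def wz addr_ge0.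
have up : 0 < u1 + u0 by lra.
have u1p : 0 <= u1 by lra.
have u0p : 0 <= u0 by lra.
set d : R := (_ - _ / (w1 + w0)).
have dE : d * ((u1 + u0) * (w1 + w0)) = 2 * (u1 * w0 - u0 * w1).
  by rewrite /d; field; rewrite !gt_eqF.
have := @cauchy_schwarz_gap (Num.sqrt w1) (Num.sqrt w0) (Num.sqrt u1) (Num.sqrt u0)
  (Num.sqrt (w1 + w0)) (Num.sqrt (u1 + u0)) d.
rewrite !sqrtr_ge0 !sqrtr_gt0 !sqr_sqrtr ?addr_ge0 // !sqrtrM ?addr_ge0 // lerD //.
by move=> h; have := h isT isT isT isT wp up erefl erefl isT dE; lra.
Qed.

(** These drops telescope along [l]. At the leaves the affinity is still at least [w y], so the
    total payment is bounded however many digits there are. *)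
Lemma sum_sqr_bias_sub u w l x : (forall y, 0 <= w y <= u y) ->
  (forall y, w y <= Num.sqrt (w y * u y)) -> upper l ->
  \sum_(y | face (mem l) x y) w y * (\sum_(i <- l) (bias u tau i y - bias w tau i y) ^+ 2)
  + 8 * mass w (mem l) x <= 8 * Num.sqrt (mass w (mem l) x * mass u (mem l) x).
Proof.
move=> wu ws; have w0 y : 0 <= w y by case/andP: (wu y).
have u0 y : 0 <= u y by case/andP: (wu y) => h; apply: le_trans.
elim: l x => [|i l IH] x ul.
  rewrite /mass.
  have E y : face (mem [::]) x y = (y == x).
    by apply/faceP/eqP => [h|->//]; apply/ffunP => i; apply: h.
  rewrite !(eq_bigl _ _ E) !big_pred1_eq big_nil mulr0 add0r.
  by rewrite ler_wpM2l.
have [ul' il lE] := upper_cons ul.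
rewrite (eq_bigr (fun y => w y * (bias u tau i x - bias w tau i x) ^+ 2 +
   (w y * \sum_(j <- l) (bias u tau j y - bias w tau j y) ^+ 2))); last first.
  by move=> y xy; rewrite big_cons !(bias_face _ ul xy) mulrDr.
rewrite big_split -mulr_suml /= -/(mass w _ _).
rewrite [X in _ + X + _](@sum_face_split _ _ (mem l) i) //.
have mE v z : mass v (mem l) z = mass v (later tau i) z.
  by apply: eq_bigl => y; apply: eq_face.
rewrite !(mass_split _ _ ul) /bias -!mE.
have B P z : 0 <= mass w P z <= mass u P z.
  rewrite mass_ge0 //=; apply: ler_sum => y _; by case/andP: (wu y).
have := two_point_bias (B (mem l) (upd x i true)) (B (mem l) (upd x i false)).
have := IH (upd x i true) ul'; have := IH (upd x i false) ul'.
lra.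
Qed.

End Chain.

End Cube.

(** * Energy and weights of events *)

Section CubePair.
Variables (R : realType) (I : finType).
Implicit Types (u v w : pred {ffun I -> bool}) (tau : I -> nat).

Definition ind u (y : {ffun I -> bool}) : R := (u y)%:R.
Definition card_ev u : R := \sum_y ind u y.

Lemma upper_enum tau : injective tau -> exists2 l : seq I, upper tau l & perm_eq l (index_enum I).
Proof.
move=> ti; pose r i j := (tau i <= tau j)%N.
exists (sort r (index_enum I)); last by rewrite perm_sort.
split; last by move=> i j _ _; rewrite mem_sort mem_index_enum.
have -> : (fun i j => tau i < tau j)%N = relpre tau ltn by [].
rewrite -sorted_map ltn_sorted_uniq_leq map_inj_uniq // sort_uniq index_enum_uniq /=.
by rewrite sorted_map; apply: sort_sorted => i j; apply: leq_total.
Qed.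

Lemma ind01 u y : ind u y = 0 \/ ind u y = 1.
Proof. by rewrite /ind; case: (u y); [right|left]. Qed.

Lemma ind_ge0 u y : 0 <= ind u y. Proof. exact: ler0n. Qed.

Lemma face_full (l : seq I) (x y : {ffun I -> bool}) :
  perm_eq l (index_enum I) -> face (mem l) x y.
Proof. by move=> pl; apply/faceP => i; rewrite /= (perm_mem pl) mem_index_enum. Qed.

Definition energy u tau y : R := \sum_i bias (ind u) tau i y ^+ 2.

Lemma sum_prod_bias_full u tau : injective tau ->
  \sum_y ind u y * \prod_i (1 + bias (ind u) tau i y ^+ 2)^-1
  = card_ev u ^+ 2 / 2 ^+ #|I|.
Proof.
move=> ti; have [l ul pl] := upper_enum ti.
have F (x : {ffun I -> bool}) : face (mem l) x =1 xpredT.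
  by move=> y /=; rewrite face_full.
have := sum_prod_bias [ffun _ => false] (ind01 u) ul.
rewrite (eq_bigl _ _ (F _)).
rewrite /mass (eq_bigl _ _ (F _)).
rewrite (perm_size pl) -/(card_ev u) -sum1_size sum1_card => <-.
by apply: eq_bigr => y _; rewrite (perm_big _ pl).
Qed.

Lemma sum_sqr_bias_full u w tau : injective tau -> (forall y, w y -> u y) ->
  \sum_y ind w y * (\sum_i (bias (ind u) tau i y - bias (ind w) tau i y) ^+ 2)
  <= 8 * card_ev u.
Proof.
move=> ti wu; have [l ul pl] := upper_enum ti.
have F (x : {ffun I -> bool}) : face (mem l) x =1 xpredT.
  by move=> y /=; rewrite face_full.
have iwu y : ind w y <= ind u y.
  by rewrite ler_nat; case: (w y) (wu y) => // ->.
have sub y : 0 <= ind w y <= ind u y by rewrite ind_ge0 iwu.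
have sq y : ind w y <= Num.sqrt (ind w y * ind u y).
  rewrite /ind; case: (w y) (wu y) => [->//|_]; last by rewrite sqrtr_ge0.
  by rewrite mulr1 sqrtr1.
have := @sum_sqr_bias_sub R I tau (ind u) (ind w) l [ffun _ => false] sub sq ul.
rewrite (eq_bigl _ _ (F _)).
rewrite {1 2}/mass (eq_bigl _ _ (F _)).
rewrite [X in 8 * Num.sqrt (_ * X)](eq_bigl _ _ (F _)).
rewrite -/(card_ev u) -/(card_ev w).
have w0 : 0 <= card_ev w by apply: sumr_ge0 => y _; apply: ind_ge0.
have wu' : card_ev w <= card_ev u by apply: ler_sum.
have : Num.sqrt (card_ev w * card_ev u) <= card_ev u.
  rewrite -[leRHS]ger0_norm ?(le_trans w0) // -sqrtr_sqr ler_wsqrtr // expr2.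
  by rewrite ler_wpM2r // (le_trans w0).
have -> : \sum_y ind w y * \sum_i (bias (ind u) tau i y - bias (ind w) tau i y) ^+ 2 =
    \sum_y ind w y * \sum_(i <- l) (bias (ind u) tau i y - bias (ind w) tau i y) ^+ 2.
  by apply: eq_bigr => y _; rewrite (perm_big _ pl).
lra.
Qed.

(** Both events are compared with their intersection, which is contained in each of them. *)
Lemma sum_sqr_bias_pair u v tau : injective tau ->
  \sum_y ind (predI u v) y * (\sum_i (bias (ind u) tau i y - bias (ind v) tau i y) ^+ 2)
  <= 16 * (card_ev u + card_ev v).
Proof.
move=> ti; set w := predI u v.
have wu y : w y -> u y by case/andP.
have wv y : w y -> v y by case/andP.
have := sum_sqr_bias_full ti wu; have := sum_sqr_bias_full ti wv.
set Sv := (X in X <= 8 * card_ev v -> _); set Su := (X in X <= 8 * card_ev u -> _).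
move=> hv hu.
apply: (@le_trans _ _ (2 * Su + 2 * Sv)); last by lra.
rewrite /Su /Sv !mulr_sumr -big_split /=; apply: ler_sum => y _.
rewrite !mulrA ![2 * ind _ _]mulrC -!mulrA -mulrDr ler_wpM2l ?ind_ge0 //.
rewrite !mulr_sumr -big_split /=; apply: ler_sum => i _.
set a := bias _ _ _ _; set b := bias _ _ _ _; set c := bias _ _ _ _.
rewrite -subr_ge0.
have -> : 2 * (a - c) ^+ 2 + 2 * (b - c) ^+ 2 - (a - b) ^+ 2 = (a + b - 2 * c) ^+ 2 by ring.
exact: sqr_ge0.
Qed.

(** Markov's inequality: by [1 + x <= expR x] the product of the inverses is at least [expR (- B)]
    wherever the energy is at most [B]. The bound is quadratic in [card_ev u], so it is small
    relative to the event when the event is rare. *)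
Lemma energy_small u tau B : injective tau ->
  \sum_(y | u y && (energy u tau y <= B)) 1 <= expR B * (card_ev u ^+ 2 / 2 ^+ #|I|).
Proof.
move=> ti; rewrite -(sum_prod_bias_full _ ti) mulr_sumr big_mkcond.
apply: ler_sum => y _; have -> : ind u y = (u y)%:R by [].
have p0 : 0 <= \prod_i (1 + bias (ind u) tau i y ^+ 2)^-1.
  by apply: prodr_ge0 => i _; rewrite invr_ge0 addr_ge0 // sqr_ge0.
case: (boolP (u y)) => uy /=; last by rewrite mul0r mulr0.
case: ifP => [eB|_]; last by rewrite mul1r mulr_ge0 ?expR_ge0.
rewrite mul1r prodfV ler_pdivlMr; last first.
  by apply: prodr_gt0 => i _; rewrite ltr_pwDl // sqr_ge0.
rewrite mul1r; apply: (@le_trans _ _ (expR (energy u tau y))); last by rewrite ler_expR.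
rewrite /energy expR_sum; apply: ler_prod => i _.
by rewrite addr_ge0 ?sqr_ge0 //= expR_ge1Dx.
Qed.

(** Division by [0] makes all weights vanish at a point of energy [0]; such points send out nothing
    instead of a unit. *)
Definition weight u tau i y : R := bias (ind u) tau i y ^+ 2 / energy u tau y.

Lemma energy_ge0 u tau y : 0 <= energy u tau y.
Proof. by apply: sumr_ge0 => i _; apply: sqr_ge0. Qed.

Lemma weight_ge0 u tau i y : 0 <= weight u tau i y.
Proof. by rewrite divr_ge0 ?energy_ge0 // sqr_ge0. Qed.

Lemma sum_weight u tau y : \sum_i weight u tau i y = (energy u tau y != 0)%:R.
Proof.
rewrite -mulr_suml -/(energy u tau y); have [->|e0] := eqVneq (energy u tau y) 0.
  by rewrite mul0r.
by rewrite divff.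
Qed.

(** Normalized squares are stable when the norm is large compared with the distance. Only [a] is
    assumed to have large norm; [b] may even vanish. *)
Lemma sum_normalized_sub (a b : I -> R) (th B : R) : 0 < th -> 0 < B ->
  B <= \sum_i a i ^+ 2 ->
  \sum_i `|a i ^+ 2 / (\sum_j a j ^+ 2) - b i ^+ 2 / (\sum_j b j ^+ 2)|
  <= 2 * th + 2 * (1 + th^-1) / B * \sum_i (a i - b i) ^+ 2.
Proof.
move=> th0 B0; set A := \sum_i a i ^+ 2; set A' := \sum_i b i ^+ 2 => BA.
have A0 : 0 < A by exact: lt_le_trans BA.
have A'0 : 0 <= A' by apply: sumr_ge0 => i _; apply: sqr_ge0.
pose T := \sum_i `|a i ^+ 2 - b i ^+ 2|.
have TA : `|A - A'| <= T by rewrite /A /A' -sumrB ler_norm_sum.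
have h1 : \sum_i `|a i ^+ 2 / A - b i ^+ 2 / A'| <= 2 * T / A.
  (* The difference is [(a i ^+ 2 - b i ^+ 2) / A] minus [b i ^+ 2 / A' * ((A - A') / A)]; the
     absolute values of either part sum to at most [T / A]. *)
  apply: (@le_trans _ _ (\sum_i (`|a i ^+ 2 - b i ^+ 2| / A +
      b i ^+ 2 / A' * (`|A - A'| / A)))).
    apply: ler_sum => i _.
    have [A'z|A'z] := eqVneq A' 0.
      have bz : b i ^+ 2 = 0.
        have /eqP := A'z; rewrite psumr_eq0; last by move=> j _; apply: sqr_ge0.
        by move=> /allP/(_ i); rewrite mem_index_enum => /(_ isT) /eqP.
      by rewrite bz !mul0r !subr0 addr0 normrM (gtr0_norm (x := A^-1)) // invr_gt0.
    have -> : a i ^+ 2 / A - b i ^+ 2 / A' =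
        (a i ^+ 2 - b i ^+ 2) / A - b i ^+ 2 / A' * ((A - A') / A).
      by field; rewrite A'z gt_eqF.
    have Ai0 : 0 <= A^-1 by rewrite invr_ge0 ltW.
    apply: le_trans (ler_normB _ _) _; apply: lerD.
      by rewrite normrM (ger0_norm Ai0).
    rewrite normrM (ger0_norm (x := _ / A')) ?divr_ge0 ?sqr_ge0 //.
    by rewrite [in leLHS]normrM (ger0_norm Ai0).
  rewrite big_split /= -mulr_suml -/T -!mulr_suml -/A'.
  have : A' / A' * `|A - A'| <= T.
    apply: le_trans TA; rewrite -[leRHS]mul1r ler_wpM2r //.
    by have [->|h] := eqVneq A' 0; [rewrite mul0r | rewrite divff].
  by rewrite mulrA -mulrDl ler_pM2r ?invr_gt0 //; lra.
apply: le_trans h1 _.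
(* [th] trades a fraction of the norm against a multiple of the squared distance; for either sign
   the slack is a sum of squares. *)
have h2 : T <= th * A + (1 + th^-1) * \sum_i (a i - b i) ^+ 2.
  rewrite /A !mulr_sumr -big_split /=; apply: ler_sum => i _.
  set x := a i; set y := b i.
  rewrite ler_norml; apply/andP; split; rewrite -subr_ge0.
    have -> : x ^+ 2 - y ^+ 2 - - (th * x ^+ 2 + (1 + th^-1) * (x - y) ^+ 2) =
      th^-1 * (th * x + (x - y)) ^+ 2 by field; rewrite gt_eqF.
    by rewrite mulr_ge0 ?sqr_ge0 ?invr_ge0 ?ltW.
  have -> : th * x ^+ 2 + (1 + th^-1) * (x - y) ^+ 2 - (x ^+ 2 - y ^+ 2) =
      th^-1 * (th * x - (x - y)) ^+ 2 + 2 * (x - y) ^+ 2 by field; rewrite gt_eqF.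
  by rewrite addr_ge0 // mulr_ge0 ?sqr_ge0 ?invr_ge0 ?ltW.
have D0 : 0 <= \sum_i (a i - b i) ^+ 2 by apply: sumr_ge0 => i _; apply: sqr_ge0.
have t1 : 0 <= 1 + th^-1 by rewrite addr_ge0 // invr_ge0 ltW.
rewrite ler_pdivrMr //; apply: (@le_trans _ _
   (2 * (th * A + (1 + th^-1) * \sum_i (a i - b i) ^+ 2))); first by rewrite ler_wpM2l.
set D := \sum_i _.
have : 2 * (1 + th^-1) * D <= 2 * (1 + th^-1) * D * (A / B).
  by rewrite ler_peMr ?mulr_ge0 // ler_pdivlMr // mul1r.
by move=> h; apply: le_trans (_ : 2 * th * A + 2 * (1 + th^-1) * D * (A / B) <= _); first lra;
  rewrite le_eqVlt; apply/orP; left; apply/eqP; ring.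
Qed.

(** Where the energy of [u] exceeds [B] the stability of normalized squares applies, and
    [64 = 2 * 16 * 2] collects its factor, that of [sum_sqr_bias_pair] and the two events of equal
    size. Elsewhere the trivial distance [2] is used, on a set bounded by [energy_small]. *)
Lemma sum_weight_sub u v tau (th B : R) : injective tau -> 0 < th -> 0 < B ->
  card_ev v = card_ev u ->
  \sum_y ind (predI u v) y * \sum_i `|weight u tau i y - weight v tau i y|
  <= (2 * th + 64 * (1 + th^-1) / B + 2 * expR B * (card_ev u / 2 ^+ #|I|)) * card_ev u.
Proof.
move=> ti th0 B0 uv.
have := sum_sqr_bias_pair u v ti; rewrite uv => hD.
have hE := energy_small u B ti.
set D := (X in X <= _) in hD.
set c := 2 * (1 + th^-1) / B.
apply: (@le_trans _ _ (2 * th * card_ev u + c * D +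
   2 * \sum_(y | u y && (energy u tau y <= B)) 1)); last first.
  have c0 : 0 <= c by rewrite /c divr_ge0 ?mulr_ge0 ?addr_ge0 ?invr_ge0 ?ltW.
  rewrite 2!(mulrDl _ _ (card_ev u)); apply: lerD; first apply: lerD => //.
    apply: le_trans (ler_wpM2l c0 hD) _.
    by rewrite /c le_eqVlt; apply/orP; left; apply/eqP; ring.
  apply: (@le_trans _ _ (2 * (expR B * (card_ev u ^+ 2 / 2 ^+ #|I|)))).
    by rewrite ler_wpM2l.
  by rewrite le_eqVlt; apply/orP; left; apply/eqP; ring.
rewrite /card_ev /D !mulr_sumr [X in _ + X]big_mkcond -!big_split /=; apply: ler_sum => y _.
have -> : ind u y = (u y)%:R by []; have -> : ind (predI u v) y = (u y && v y)%:R by [].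
case: (boolP (u y)) => uy /=; last by rewrite !(mul0r, mulr0, addr0).
case: (boolP (v y)) => vy; rewrite !(mul0r, mulr0, addr0, mul1r, mulr1) /=.
  have := @sum_normalized_sub (fun i => bias (ind u) tau i y) (fun i => bias (ind v) tau i y) th B th0 B0.
  have [hB _|hB] := leP (energy u tau y) B; last first.
    by move=> /(_ (ltW hB)); rewrite addr0; apply.
  have h2 : \sum_i `|weight u tau i y - weight v tau i y| <= 2.
    apply: (@le_trans _ _ (\sum_i (weight u tau i y + weight v tau i y))).
      apply: ler_sum => i _; apply: le_trans (ler_normB _ _) _.
      by rewrite !ger0_norm ?weight_ge0.
    rewrite big_split /= !sum_weight; do 2 case: (_ != _) => /=; lra.
  apply: le_trans h2 _; rewrite lerDr addr_ge0 ?mulr_ge0 ?(ltW th0) //.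
  - by rewrite addr_ge0 // invr_ge0 ltW.
  - by rewrite invr_ge0 ltW.
  - by apply: sumr_ge0 => i _; apply: sqr_ge0.
by rewrite addr_ge0 // ?mulr_ge0 ?(ltW th0) //; case: ifP => _ //; rewrite mulr_ge0.
Qed.

End CubePair.

(** * Dependence on additional digits *)

Section Pullback.
Variables (R : numFieldType) (A : finType) (a0 : A) (K J : finType) (th : K -> J).
Hypothesis th_inj : injective th.

Definition pull (z : {ffun J -> A}) : {ffun K -> A} := [ffun k => z (th k)].

(** A fibre is a product: coordinates in the image of [th] or outside [P] are prescribed and the
    others are free, so its size depends neither on [x] nor on [z0]. *)
Lemma card_fiber_pull (P : pred J) : exists2 c : nat, (0 < c)%N &
  forall (x : {ffun J -> A}) (z0 : {ffun K -> A}),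
    face (fun k => P (th k)) (pull x) z0 ->
    #|[pred z | face P x z & pull z == z0]| = c.
Proof.
pose pre j := [pick k | th k == j].
exists (\prod_j if pre j is Some _ then 1 else if P j then #|A| else 1)%N.
  rewrite prodn_gt0 // => j; case: (pre j) => //; case: (P j) => //.
  by apply/card_gt0P; exists a0.
move=> x z0 /faceP xz0.
pose F j := if pre j is Some k then pred1 (z0 k) else if P j then predT else pred1 (x j).
have -> : #|[pred z | face P x z & pull z == z0]| = #|family F|.
  apply: eq_card => z; rewrite inE; apply/andP/familyP => [[/faceP xz /eqP zz0] j|h].
    rewrite /F /pre; case: pickP => [k /eqP <-|_].
      by rewrite inE -zz0 ffunE.
    by case: (boolP (P j)) => // Pj; rewrite inE xz.
  have zth k : z (th k) = z0 k.
    have := h (th k); rewrite /F /pre; case: pickP => [k' /eqP/th_inj ->|/(_ k)].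
      by rewrite inE => /eqP.
    by rewrite eqxx.
  split; last by apply/eqP/ffunP => k; rewrite ffunE.
  apply/faceP => j Pj; have := h j; rewrite /F /pre; case: pickP => [k /eqP kj|_].
    move=> _; rewrite -kj zth xz0 ?ffunE //; by rewrite kj.
  by rewrite (negbTE Pj) inE => /eqP.
rewrite card_family foldrE big_map big_enum /=; apply: eq_bigr => j _.
by rewrite /F; case: (pre j) => [k|]; [rewrite card1|case: ifP => _; rewrite ?card1].
Qed.

Lemma sum_face_pull (P : pred J) : exists2 c : nat, (0 < c)%N &
  forall (x : {ffun J -> A}) (F : {ffun K -> A} -> R),
    \sum_(z | face P x z) F (pull z) =
    c%:R * \sum_(z0 | face (fun k => P (th k)) (pull x) z0) F z0.
Proof.
have [c c0 h] := card_fiber_pull P; exists c => // x F.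
rewrite (partition_big pull (face (fun k => P (th k)) (pull x))) /=; last first.
  by move=> z /faceP xz; apply/faceP => k Pk; rewrite !ffunE xz.
rewrite mulr_sumr; apply: eq_bigr => z0 xz0.
rewrite (eq_bigr (fun=> F z0)); last by move=> z /andP[_ /eqP ->].
by rewrite sumr_const (h _ _ xz0) mulr_natl.
Qed.

End Pullback.

Section BiasPull.
Variables (R : rcfType) (K J : finType) (th : K -> J).
Hypothesis th_inj : injective th.
Variables (u : {ffun K -> bool} -> R) (tau : J -> nat).

Let up (z : {ffun J -> bool}) := u (pull th z).

Lemma mass_pull (P : pred J) : exists2 c : R, c != 0 &
  forall x, mass up P x = c * mass u (fun k => P (th k)) (pull th x).
Proof.
have [c c0 h] := sum_face_pull R true th_inj P.
by exists c%:R => [|x]; [rewrite pnatr_eq0 -lt0n|apply: h].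
Qed.

(** The constant fibre size cancels in the quotient. An event can thus be studied on any larger
    cube, where it meets its translates, without changing its biases. *)
Lemma bias_pull k x : bias up tau (th k) x = bias u (tau \o th) k (pull th x).
Proof.
rewrite /bias; have [c c0 h] := mass_pull (later tau (th k)); rewrite !h.
have E b : pull th (upd x (th k) b) = upd (pull th x) k b.
  by apply/ffunP => j; rewrite !ffunE (inj_eq th_inj).
rewrite !E -mulrBr -mulrDr invfM mulrACA divff // mul1r.
by congr (_ / _).
Qed.

Lemma bias_pull_out j x : (forall k, th k != j) -> bias up tau j x = 0.
Proof.
move=> kj; rewrite /bias; have [c c0 h] := mass_pull (later tau j); rewrite !h.
have E b : pull th (upd x j b) = pull th x.
  by apply/ffunP => k; rewrite !ffunE (negbTE (kj k)).
by rewrite !E subrr mul0r.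
Qed.

End BiasPull.

Section Window.
Variables (R : numFieldType) (I : choiceType) (A : finType) (a0 : A).
Implicit Types (J K : {fset I}).

Definition ext J (c : {ffun J -> A}) : I -> A :=
  fun i => if insub i is Some k then c k else a0.

Definition depends_on (T : Type) J (phi : (I -> A) -> T) :=
  forall om om' : I -> A, {in J, om =1 om'} -> phi om = phi om'.

(** The mean under iid uniform labels provided that [phi] depends only on [J]; labels outside [J]
    are frozen at [a0]. Hence the dependence hypotheses wherever the window changes. *)
Definition expect J (phi : (I -> A) -> R) : R :=
  #|{ffun J -> A}|%:R^-1 * \sum_(c : {ffun J -> A}) phi (ext c).

Lemma ext_val J (c : {ffun J -> A}) (k : J) : ext c (val k) = c k.
Proof. by rewrite /ext valK. Qed.

Lemma card_configs_gt0 J : 0 < #|{ffun J -> A}|%:R :> R.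
Proof. by rewrite ltr0n; apply/card_gt0P; exists [ffun=> a0]. Qed.

Lemma expect_comp (f : I -> I) K J (phi : (I -> A) -> R) : injective f ->
  depends_on K phi -> {in K, forall i, f i \in J} ->
  expect J (fun om => phi (om \o f)) = expect K phi.
Proof.
move=> fi dK KJ; pose th (k : K) : J := [` KJ (val k) (valP k)]%fset.
have thi : injective th by move=> k k' /(congr1 val) /= /fi /val_inj.
have [c c0 h] := sum_face_pull R a0 thi predT.
pose F (z : {ffun K -> A}) := phi (ext z).
have full (L : {fset I}) (P : pred L) (x y : {ffun L -> A}) : (forall k, P k) -> face P x y.
  by move=> PT; apply/faceP => k; rewrite PT.
have E (z : {ffun J -> A}) : phi (ext z \o f) = phi (ext (pull th z)).
  apply: dK => i iK /=; have -> : f i = val (th [` iK]%fset) by [].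
  by rewrite ext_val -[i in RHS]/(val [` iK]%fset) ext_val ffunE.
have S (G : {ffun K -> A} -> R) :
    \sum_(z : {ffun J -> A}) G (pull th z) = c%:R * \sum_z0 G z0.
  apply: etrans (etrans _ (h [ffun=> a0] G)) _.
    by apply: eq_bigl => z; rewrite full.
  by congr (_ * _); apply: eq_bigl => z; rewrite full.
rewrite /expect (eq_bigr (fun z => F (pull th z))); last by move=> z _; rewrite E.
have cJ : #|{ffun J -> A}|%:R = c%:R * #|{ffun K -> A}|%:R :> R.
  by have := S (fun=> 1); rewrite !sumr_const.
rewrite S cJ /F; field.
by rewrite !gt_eqF ?card_configs_gt0 // ltr0n.
Qed.

Lemma expect_sub K J (phi : (I -> A) -> R) : depends_on K phi -> (K `<=` J)%fset ->
  expect J phi = expect K phi.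
Proof. by move=> dK /fsubsetP KJ; apply: (@expect_comp id). Qed.

(** Stationarity of iid labels, although [f] need not preserve the window: both sides are computed
    on a window containing [K] and its image. *)
Lemma expect_shift K (f : I -> I) (phi : (I -> A) -> R) : injective f ->
  depends_on K phi -> depends_on K (fun om => phi (om \o f)) ->
  expect K (fun om => phi (om \o f)) = expect K phi.
Proof.
move=> fi d1 d2; pose J := (K `|` [fset f i | i in K])%fset.
rewrite -(@expect_sub _ J _ d2) ?fsubsetUl //.
apply: expect_comp => // i iK; rewrite inE; apply/orP; right.
by apply/imfsetP; exists i.
Qed.

Lemma expect_le J (phi psi : (I -> A) -> R) : (forall om, phi om <= psi om) ->
  expect J phi <= expect J psi.
Proof.
move=> le; apply: ler_wpM2l; first by rewrite invr_ge0 ltW ?card_configs_gt0.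
by apply: ler_sum => c _; apply: le.
Qed.

Lemma expectD J (phi psi : (I -> A) -> R) :
  expect J (fun om => phi om + psi om) = expect J phi + expect J psi.
Proof. by rewrite /expect big_split /= mulrDr. Qed.

Lemma expectZ J (c : R) (phi : (I -> A) -> R) :
  expect J (fun om => c * phi om) = c * expect J phi.
Proof. by rewrite /expect -mulr_sumr mulrCA. Qed.

Lemma expect_sum J (T : Type) (s : seq T) (phi : T -> (I -> A) -> R) :
  expect J (fun om => \sum_(t <- s) phi t om) = \sum_(t <- s) expect J (phi t).
Proof. by rewrite /expect exchange_big /= mulr_sumr. Qed.

End Window.

Section WeightPull.
Variables (R : realType) (K J : finType) (th : K -> J).
Hypothesis th_inj : injective th.

Lemma sum_pull (F : J -> R) : (forall j, (forall k, th k != j) -> F j = 0) ->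
  \sum_j F j = \sum_k F (th k).
Proof.
move=> F0; rewrite (bigID (mem [set th k | k in K])) /= [X in _ + X]big1 ?addr0.
  by rewrite big_imset //= => k k' _ _; apply: th_inj.
move=> j jth; apply: F0 => k; apply: contraNneq jth => <-.
by apply/imsetP; exists k.
Qed.

Lemma le_sum_pull (F : J -> R) : (forall j, 0 <= F j) -> \sum_k F (th k) <= \sum_j F j.
Proof.
move=> F0; rewrite [leRHS](bigID (mem [set th k | k in K])) /=.
rewrite big_imset //=; last by move=> k k' _ _; apply: th_inj.
by rewrite lerDl sumr_ge0.
Qed.

Variables (u : pred {ffun K -> bool}) (tau : J -> nat).

Definition pull_ev : pred {ffun J -> bool} := fun z => u (pull th z).

Lemma energy_pull x : energy R pull_ev tau x = energy R u (tau \o th) (pull th x).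
Proof.
rewrite /energy sum_pull => [|j kj].
  by apply: eq_bigr => k _; rewrite (@bias_pull R K J th th_inj (ind R u) tau).
by rewrite (@bias_pull_out R K J th th_inj (ind R u) tau) ?expr0n.
Qed.

Lemma weight_pull k x : weight R pull_ev tau (th k) x = weight R u (tau \o th) k (pull th x).
Proof.
by rewrite /weight energy_pull (@bias_pull R K J th th_inj (ind R u) tau).
Qed.

Lemma weight_pull_out j x : (forall k, th k != j) -> weight R pull_ev tau j x = 0.
Proof.
move=> kj; rewrite /weight (@bias_pull_out R K J th th_inj (ind R u) tau) //.
by rewrite expr0n mul0r.
Qed.

End WeightPull.

Section PairConfigs.
Variables (R : numFieldType) (I : choiceType) (A B : finType) (J : {fset I}).

Lemma sum_pair_configs (V : nmodType) (F : {ffun J -> A * B} -> V) :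
  \sum_c F c = \sum_(b : {ffun J -> B}) \sum_(a : {ffun J -> A}) F [ffun j => (a j, b j)].
Proof.
rewrite pair_big /= (reindex (fun c : {ffun J -> A * B} =>
  ([ffun j => (c j).2], [ffun j => (c j).1]))) /=; last first.
  exists (fun p : {ffun J -> B} * {ffun J -> A} => [ffun j => (p.2 j, p.1 j)]).
    by move=> c _; apply/ffunP => j; rewrite !ffunE; case: (c j).
  by move=> [b a] _; congr (_, _); apply/ffunP => j; rewrite !ffunE.
apply: eq_bigr => c _; congr F; apply/ffunP => j; rewrite !ffunE; by case: (c j).
Qed.

(** Fubini with the first components innermost, so that estimates on the cube of digits apply to
    each fixed assignment of times. *)
Lemma expect_pair (a0 : A) (b0 : B) (phi : (I -> A * B) -> R) :
  expect (a0, b0) J phi =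
  #|{ffun J -> B}|%:R^-1 * \sum_(b : {ffun J -> B}) (#|{ffun J -> A}|%:R^-1 *
    \sum_(a : {ffun J -> A}) phi (ext (a0, b0) [ffun j => (a j, b j)])).
Proof.
rewrite /expect; have -> : #|{ffun J -> A * B}| = (#|{ffun J -> B}| * #|{ffun J -> A}|)%N.
  rewrite -sum1_card sum_pair_configs -sum1_card big_distrl /=.
  by apply: eq_bigr => b _; rewrite mul1n sum1_card.
by rewrite sum_pair_configs -mulr_sumr natrM invfM mulrA.
Qed.

End PairConfigs.

(** * Collisions of discretized times *)

Section Ties.

(** [T (T ^ n - T ^_ n) <= n ^ 2 T ^ n], without subtraction. *)
Lemma ffact_lower (T n : nat) : (T * T ^ n <= n ^ 2 * T ^ n + T * T ^_ n)%N.
Proof.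
elim: n => [|n IH]; first by rewrite expn0 ffactn0 mul0n.
rewrite ffactnSr expnS.
have h1 : (T ^_ n <= T ^ n)%N.
  by rewrite -(card_ord T) -{1}(card_ord n) -card_inj_ffuns -[in leqRHS](card_ord n) -card_ffun max_card.
have h2 : (T <= (T - n) + n)%N by lia.
have h3 := leq_mul (leqnn (T * T ^_ n)) h2.
have h4 := leq_mul (leqnn T) IH.
have h5 := leq_mul (leqnn (n * T)) h1.
move: h3 h4 h5; set a := (T ^ n)%N; set b := (T ^_ n)%N; set c := (T - n)%N.
rewrite -!mulnn; lia.
Qed.

Lemma few_ties (R : realType) (n : nat) (e : R) : 0 < e ->
  exists T, forall J : finType, (#|J| <= n)%N ->
    #|[pred t : {ffun J -> 'I_T.+1} | ~~ injectiveb t]|%:R <=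
    e * #|{ffun J -> 'I_T.+1}|%:R.
Proof.
move=> e0; exists (Num.truncn (n%:R ^+ 2 / e)) => J Jn; set T := Num.truncn _.
have := ffact_lower T.+1 #|J|.
have -> : (T.+1 ^_ #|J|)%N = #|[pred t : {ffun J -> 'I_T.+1} | injectiveb t]|.
  rewrite -{1}(card_ord T.+1) -card_inj_ffuns cardsE; apply: eq_card => t.
  by rewrite !inE.
have cE : #|{ffun J -> 'I_T.+1}| = (T.+1 ^ #|J|)%N by rewrite card_ffun card_ord.
have := cardC [pred t : {ffun J -> 'I_T.+1} | injectiveb t].
rewrite cE; set a := #|_|; set b := #|_| => ab.
set x := (X in X%:R <= _); have -> : x = b by apply: eq_card.
rewrite -ab => h.
have {}h : (T.+1 * b <= #|J| ^ 2 * (T.+1 ^ #|J|))%N.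
  by move: h; rewrite mulnDr addnC leq_add2r ab.
have {}h : T.+1%:R * b%:R <= n%:R ^+ 2 * (T.+1 ^ #|J|)%:R :> R.
  by rewrite -natrX -!natrM ler_nat (leq_trans h) // leq_mul2r leq_sqr Jn orbT.
have hT : n%:R ^+ 2 <= e * T.+1%:R.
  rewrite mulrC -ler_pdivrMr // ltW //.
  by have /andP[] := Num.Theory.truncn_itv (x := n%:R ^+ 2 / e) (divr_ge0 (sqr_ge0 _) (ltW e0)).
have T0 : 0 < T.+1%:R :> R by rewrite ltr0n.
rewrite -(ler_pM2l T0); apply: le_trans h _.
by rewrite ab mulrA [T.+1%:R * e]mulrC ler_wpM2r.
Qed.

End Ties.

(** * Labelled digits of a group *)

Section Model.
Variables (R : realType) (G : countGroupType).
Local Notation I := (G * nat)%type.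
Local Notation gmul := (@monoid.mul G).
Local Notation ginv := (@monoid.inv G).
Local Notation gone := (@monoid.one G).

Definition gact (g : G) (i : I) : I := (gmul g i.1, i.2).
(** The configuration viewed from [g], that is, moved by [g^-1]: the point [g] lies in the random
    set when the event holds for [shift g om]. *)
Definition shift (A : Type) (g : G) (om : I -> A) : I -> A := fun i => om (gact g i).

Lemma gactM g h i : gact g (gact h i) = gact (gmul g h) i.
Proof. by rewrite /gact /= mulgA. Qed.

Lemma gact1 i : gact gone i = i.
Proof. by rewrite /gact mul1g; case: i. Qed.

Lemma gactK g : cancel (gact g) (gact (ginv g)).
Proof. by move=> i; rewrite gactM mulVg gact1. Qed.

Lemma gactVK g : cancel (gact (ginv g)) (gact g).
Proof. by move=> i; rewrite gactM mulgV gact1. Qed.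

Lemma gact_inj g : injective (gact g). Proof. exact: can_inj (gactK g). Qed.

Lemma shiftM A g h (om : I -> A) : shift g (shift h om) = shift (gmul h g) om.
Proof. by apply/funext => i; rewrite /shift gactM. Qed.

Lemma shift1 A (om : I -> A) : shift gone om = om.
Proof. by apply/funext => i; rewrite /shift gact1. Qed.

Variables (K : {fset I}) (u : (I -> bool) -> bool) (T : nat).
Hypothesis du : depends_on K u.

(** A label consists of a digit and its (discretized) time; the site [(g, j)] carries the [j]-th
    binary digit of the real number at [g]. *)
Local Notation L := (bool * 'I_T.+1)%type.
Local Notation a0 := ((false, ord0) : L).
Implicit Types (om : I -> L).

Definition bits om : I -> bool := fun i => (om i).1.
Definition times om : I -> nat := fun i => (om i).2.
Definition hit om : bool := u (bits om).
Definition uK : pred {ffun K -> bool} := fun z => u (ext false z).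
(** The mass that the root, if hit, sends to the site [i]. What a point [g] sends to [i] is read in
    [shift g om] at the site [gact (ginv g) i]. *)
Definition wt om (i : I) : R :=
  if insub i is Some k then
    weight R uK (fun k' : K => times om (val k')) k [ffun k' => bits om (val k')]
  else 0.

Lemma hit_dep : depends_on K hit.
Proof. by move=> om om' h; apply: du => i iK; rewrite /bits h. Qed.

Lemma wt_dep i : depends_on K (wt ^~ i).
Proof.
move=> om om' h; rewrite /wt; case: insubP => [k _ _|//].
have h' (k' : K) : om (val k') = om' (val k') by apply: h; apply: fsvalP.
have -> : (fun k' : K => times om (val k')) = (fun k' : K => times om' (val k')).
  by apply/funext => k'; rewrite /times h'.
have -> // : [ffun k' : K => bits om (val k')] = [ffun k' : K => bits om' (val k')].
by apply/ffunP => k'; rewrite !ffunE /bits h'.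
Qed.

Lemma wt_ge0 om i : 0 <= wt om i.
Proof. by rewrite /wt; case: insubP => // k _ _; apply: weight_ge0. Qed.

Lemma wt_out om i : i \notin K -> wt om i = 0.
Proof. by move=> iK; rewrite /wt insubN. Qed.

Definition total_wt om : R := \sum_(k : K) wt om (val k).

Lemma total_wt_dep : depends_on K total_wt.
Proof. by move=> om om' h; apply: eq_bigr => k _; apply: wt_dep h. Qed.

Section Translate.
Variables (J : {fset I}) (h : G).
Hypothesis KJ : {in K, forall i, gact h i \in J}.

Definition emb (k : K) : J := [` KJ (fsvalP k)]%fset.

Lemma emb_inj : injective emb.
Proof. by move=> k k' /(congr1 val) /= /gact_inj /val_inj. Qed.

Variables (y : {ffun J -> bool}) (t : {ffun J -> 'I_T.+1}).
Let om := ext a0 [ffun j : J => (y j, t j)].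

Lemma shift_ext (k : K) : shift h om (val k) = (y (emb k), t (emb k)).
Proof.
rewrite /shift -[gact h _]/(val (emb k)) /om ext_val ffunE; by [].
Qed.

Lemma bits_pull : [ffun k : K => bits (shift h om) (val k)] = pull emb y.
Proof. by apply/ffunP => k; rewrite !ffunE /bits shift_ext. Qed.

Lemma hit_pull : hit (shift h om) = pull_ev emb uK y.
Proof.
apply: du => i iK; rewrite -[i]/(val [` iK]%fset) ext_val -bits_pull ffunE; by [].
Qed.

(** Seen from [h], the event is another event on the same cube with the same times, so the weights
    of different points stem from one revelation order, as the pair estimate requires. *)
Lemma wt_pull (j : J) : wt (shift h om) (gact (ginv h) (val j)) =
  weight R (pull_ev emb uK) (fun j => t j : nat) j y.
Proof.
rewrite /wt; case: insubP => [k _ kj|jK].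
  have -> : j = emb k by apply/val_inj; rewrite /= kj gactVK.
  rewrite (weight_pull R emb_inj) bits_pull; congr (weight R uK _ k _).
  by apply/funext => k'; rewrite /times shift_ext.
rewrite (weight_pull_out R emb_inj) // => k; apply/negP => /eqP kj.
by move: jK; rewrite -kj /= gactK => /negP; apply; apply: fsvalP.
Qed.

End Translate.

End Model.

(** * Averages over random digits and times *)

Section PairEstimate.
Variables (R : realType) (G : countGroupType).
Local Notation I := (G * nat)%type.
Local Notation ginv := (@monoid.inv G).
Local Notation gone := (@monoid.one G).
Variables (K : {fset I}) (u : (I -> bool) -> bool) (T : nat).
Hypothesis du : depends_on K u.
Local Notation L := (bool * 'I_T.+1)%type.
Local Notation a0 := ((false, ord0) : L).
Implicit Types (om : I -> L).

Definition prob_ev : R := expect false K (fun y => (u y)%:R).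

Let tie (J : {fset I}) (e : R) :=
  #|[pred t : {ffun J -> 'I_T.+1} | ~~ injectiveb t]|%:R <= e * #|{ffun J -> 'I_T.+1}|%:R.

Lemma prob_ev_ge0 : 0 <= prob_ev.
Proof. by rewrite /prob_ev /expect mulr_ge0 ?invr_ge0 // sumr_ge0. Qed.

Lemma card_ev_pull (J : {fset I}) h (KJ : {in K, forall i, gact h i \in J}) :
  card_ev R (pull_ev (emb KJ) (uK u)) = #|{ffun J -> bool}|%:R * prob_ev.
Proof.
have d : depends_on K (fun y => (u y)%:R : R).
  by move=> y y' yy'; rewrite (du yy').
rewrite /prob_ev -(@expect_comp R I bool false (gact h) K J _ (@gact_inj G h) d KJ).
rewrite /expect mulrA divff ?mul1r ?gt_eqF ?card_configs_gt0 //; last exact: false.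
apply: eq_bigr => y _; rewrite /ind /pull_ev /uK; congr (nat_of_bool _)%:R.
apply: du => i iK /=; rewrite -[i]/(val [` iK]%fset) ext_val ffunE.
by rewrite -[gact h _]/(val (emb KJ [` iK]%fset)) ext_val.
Qed.

(** The cube estimates need distinct times; tied times have proportion at most [e] and only the
    crude bound [D] is spent on them. *)
Lemma expect_times (J : {fset I}) (phi : (I -> L) -> R) (C D e : R) : 0 <= D -> 0 <= C ->
  tie J e ->
  (forall t : {ffun J -> 'I_T.+1}, injective t ->
    \sum_(y : {ffun J -> bool}) phi (ext a0 [ffun j => (y j, t j)]) <=
    C * #|{ffun J -> bool}|%:R) ->
  (forall t : {ffun J -> 'I_T.+1},
    \sum_(y : {ffun J -> bool}) phi (ext a0 [ffun j => (y j, t j)]) <=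
    D * #|{ffun J -> bool}|%:R) ->
  expect a0 J phi <= C + D * e.
Proof.
move=> D0 C0 te hC hD.
have A0 : 0 < #|{ffun J -> bool}|%:R :> R by apply: card_configs_gt0; exact: false.
have B0 : 0 < #|{ffun J -> 'I_T.+1}|%:R :> R by apply: card_configs_gt0; exact: ord0.
rewrite expect_pair mulrC ler_pdivrMr // mulrDl.
apply: (@le_trans _ _ (\sum_(t : {ffun J -> 'I_T.+1}) (C + (if ~~ injectiveb t then D else 0)))).
  apply: ler_sum => t _; rewrite mulrC ler_pdivrMr //.
  case: ifPn => ti.
    by apply: le_trans (hD t) _; rewrite ler_wpM2r // lerDr.
  by rewrite addr0 hC //; apply/injectiveP; move: ti; rewrite negbK.
rewrite big_split /= sumr_const mulr_natr lerD2l -big_mkcond sumr_const.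
by rewrite -[D *+ _]mulr_natr -mulrA ler_wpM2l.
Qed.

Lemma KJ1 (J : {fset I}) : (K `<=` J)%fset -> {in K, forall i, gact gone i \in J}.
Proof. by move=> /fsubsetP KJ i iK; rewrite gact1 KJ. Qed.

Lemma expect_hit (J : {fset I}) : (K `<=` J)%fset ->
  expect a0 J (fun om => (hit u om)%:R) = prob_ev.
Proof.
move=> KJ; rewrite expect_pair.
have A0 : 0 < #|{ffun J -> bool}|%:R :> R by apply: card_configs_gt0; exact: false.
have B0 : 0 < #|{ffun J -> 'I_T.+1}|%:R :> R by apply: card_configs_gt0; exact: ord0.
rewrite (eq_bigr (fun=> prob_ev)) => [|t _].
  by rewrite sumr_const -[prob_ev *+ _]mulr_natr mulrCA mulVf ?mulr1 ?gt_eqF.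
rewrite -[RHS](mulKf (lt0r_neq0 A0)); congr (_ * _).
rewrite -(card_ev_pull (KJ1 KJ)); apply: eq_bigr => y _.
by rewrite -[X in hit u X]shift1 (hit_pull du (KJ1 KJ)).
Qed.

(** The total weight vanishes exactly when the energy does, so this is [energy_small] at [B = 0],
    plus the ties. *)
Lemma expect_defect (e : R) : tie K e ->
  expect a0 K (fun om => (hit u om && (total_wt R K u om == 0))%:R) <=
  (prob_ev + e) * prob_ev.
Proof.
move=> te; rewrite mulrDl [e * _]mulrC.
have KK := KJ1 (fsubset_refl K).
have A0 : 0 < #|{ffun K -> bool}|%:R :> R by apply: card_configs_gt0; exact: false.
have cE : #|{ffun K -> bool}|%:R = 2 ^+ #|{: K}| :> R by rewrite card_ffun card_bool natrX.
set U := pull_ev (emb KK) (uK u).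
have hE (y : {ffun K -> bool}) (t : {ffun K -> 'I_T.+1}) : let om := ext a0 [ffun j : K => (y j, t j)] in
    hit u om = U y /\ total_wt R K u om = (energy R U (fun j => t j : nat) y != 0)%:R.
  move=> om; split; first by rewrite -[om]shift1 (hit_pull du KK).
  rewrite -(sum_weight R U) /total_wt; apply: eq_bigr => k _.
  by rewrite -(wt_pull R u KK) shift1 invg1 gact1.
apply: expect_times => //; first exact: prob_ev_ge0; first by rewrite mulr_ge0 ?prob_ev_ge0.
  move=> t ti; have ti' : injective (fun j => t j : nat) by move=> i j /ord_inj /ti.
  have := @energy_small R _ U _ 0 ti'; rewrite expR0 mul1r (card_ev_pull KK) cE.
  have -> : (2 ^+ #|{: K}| * prob_ev) ^+ 2 / 2 ^+ #|{: K}| = prob_ev * prob_ev * 2 ^+ #|{: K}|.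
    by field; rewrite expf_neq0.
  apply: le_trans; rewrite [leRHS]big_mkcond /=; apply: ler_sum => y _.
  have [-> ->] := hE y t; case: (U y) => //=.
  rewrite pnatr_eq0 eqb0 negbK; case: eqP => [->|_] /=; first by rewrite lexx.
  by case: ifP.
move=> t; rewrite mulrC -(card_ev_pull KK); apply: ler_sum => y _.
by have [-> _] := hE y t; rewrite /ind -/U; case: (U y) => //=; case: (_ == _).
Qed.

Lemma expect_wt_sub (g : G) (J : {fset I}) (th B e : R) : 0 < th -> 0 < B ->
  tie J e -> (K `<=` J)%fset -> {in K, forall i, gact g i \in J} ->
  expect a0 J (fun om => (hit u om && hit u (shift g om))%:R *
     \sum_(k : K) `|wt R K u om (val k) - wt R K u (shift g om) (gact (ginv g) (val k))|) <=
  (2 * th + 64 * (1 + th^-1) / B + 2 * expR B * prob_ev + 2 * e) * prob_ev.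
Proof.
move=> th0 B0 te KJ0 KJ; rewrite mulrDl [2 * e * _]mulrAC.
have KK := KJ1 KJ0; have p0 := prob_ev_ge0.
have A0 : 0 < #|{ffun J -> bool}|%:R :> R by apply: card_configs_gt0; exact: false.
have cE : #|{ffun J -> bool}|%:R = 2 ^+ #|{: J}| :> R by rewrite card_ffun card_bool natrX.
set U := pull_ev (emb KK) (uK u); set V := pull_ev (emb KJ) (uK u).
have UV : card_ev R V = card_ev R U by rewrite !card_ev_pull.
have hE (y : {ffun J -> bool}) (t : {ffun J -> 'I_T.+1}) : let om := ext a0 [ffun j : J => (y j, t j)] in
    [/\ hit u om = U y, hit u (shift g om) = V y &
    \sum_(k : K) `|wt R K u om (val k) - wt R K u (shift g om) (gact (ginv g) (val k))| <=
    \sum_j `|weight R U (fun j => t j : nat) j y - weight R V (fun j => t j : nat) j y|].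
  move=> om; split; [by rewrite -[om]shift1 (hit_pull du KK)|by rewrite (hit_pull du KJ)|].
  pose D j := `|weight R U (fun j => t j : nat) j y - weight R V (fun j => t j : nat) j y|.
  have hD : \sum_k D (emb KK k) <= \sum_j D j.
    by apply: le_sum_pull => [|j]; [exact: emb_inj|exact: normr_ge0].
  apply: le_trans hD; rewrite /D.
  rewrite le_eqVlt; apply/orP; left; apply/eqP; apply: eq_bigr => k _.
  by rewrite -(wt_pull R u KK) -(wt_pull R u KJ) shift1 /= gactK gact1.
have C0 : 0 <= 2 * th + 64 * (1 + th^-1) / B + 2 * expR B * prob_ev.
  have t1 : 0 <= th^-1 by rewrite invr_ge0 ltW.
  rewrite addr_ge0 //; last by apply: mulr_ge0 => //; apply: mulr_ge0 => //; apply: expR_ge0.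
  by rewrite addr_ge0 ?mulr_ge0 ?addr_ge0 ?invr_ge0 // ltW.
apply: expect_times => //; [by rewrite mulr_ge0|by rewrite mulr_ge0| |].
  move=> t ti; have ti' : injective (fun j => t j : nat) by move=> i j /ord_inj /ti.
  have := @sum_weight_sub R _ U V _ th B ti' th0 B0 UV.
  rewrite (card_ev_pull KK) cE [2 ^+ _ * _ / _]mulrAC divff ?expf_neq0 // mul1r.
  rewrite [2 ^+ _ * _]mulrC mulrA.
  apply: le_trans; apply: ler_sum => y _; have [-> -> h] := hE y t.
  by rewrite /ind /=; apply: ler_wpM2l.
move=> t; rewrite -mulrA [prob_ev * _]mulrC -(card_ev_pull KK) mulr_sumr.
apply: ler_sum => y _; have [-> -> h] := hE y t.
rewrite /ind -/U /=; case: (U y) => /=; last by rewrite mul0r mulr0.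
case: (V y) => /=; last by rewrite mul0r mulr1.
rewrite mul1r mulr1; apply: le_trans h _.
apply: (@le_trans _ _ (\sum_j (weight R U (fun j => t j : nat) j y +
   weight R V (fun j => t j : nat) j y))).
  apply: ler_sum => j _; apply: le_trans (ler_normB _ _) _.
  by rewrite !ger0_norm ?weight_ge0.
by rewrite big_split /= !sum_weight; do 2 case: (_ != _) => /=; lra.
Qed.

End PairEstimate.

Section UniformLaw.
Variables (d : measure_display) (X : measurableType d) (R : realType) (x0 : X) (s : seq X).

Let len : {nonneg R} := NngNum (ler0n R (size (x0 :: s))).

(** The empirical measure of a nonempty list, counted with repetitions; it is given by counting on
    every set, measurable or not. *)
Definition ulaw : set X -> \bar R :=
  mscale (len%:num^-1)%:nng (msum (fun n => dirac (nth x0 (x0 :: s) n)) (size (x0 :: s))).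

HB.instance Definition _ := Measure.on ulaw.

Lemma ulawE (B : set X) :
  ulaw B = ((count (fun x => `[< B x >]) (x0 :: s))%:R / (size (x0 :: s))%:R)%:E.
Proof.
have H l : (\sum_(0 <= k < size l) dirac (nth x0 l k) B =
    ((count (fun x => `[< B x >]) l)%:R)%:E :> \bar R)%E.
  rewrite -(big_nth x0 predT (fun x => dirac x B)).
  elim: l => [|x l IH]; first by rewrite big_nil.
  by rewrite big_cons IH /= natrD EFinD /dirac indicE.
rewrite /ulaw /mscale mulrC EFinM -H big_mkord; congr (_ * _)%E.
Qed.

Lemma ulaw_setT : ulaw [set: X] = 1%E.
Proof.
rewrite ulawE (eq_count (a2 := predT)) ?count_predT; last by move=> x; apply/asboolP.
by rewrite divff // pnatr_eq0.
Qed.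

HB.instance Definition _ := Measure_isProbability.Build _ _ _ ulaw ulaw_setT.

Definition uniform_law : probability X R := ulaw.

End UniformLaw.

Section PartialShift.

(** Reindexing by a bijection that does not preserve [s]: the terms that would cross its border
    vanish. It serves to translate a sum over the finitely many sites of [K]. *)
Lemma sum_partial_bij (V : nmodType) (I : eqType) (s : seq I) (f f' : I -> I) (a b : I -> V) :
  uniq s -> cancel f f' -> cancel f' f ->
  (forall k, k \in s -> f' k \notin s -> a k = 0) ->
  (forall k, k \in s -> f k \notin s -> b k = 0) ->
  (forall k, k \in s -> f k \in s -> a (f k) = b k) ->
  \sum_(k <- s) a k = \sum_(k <- s) b k.
Proof.
move=> us fK f'K a0 b0 ab.
rewrite big_seq (bigID (fun k => f' k \in s)) /= [X in _ + X]big1 ?addr0; last first.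
  by move=> k /andP[ks f'k]; apply: a0.
rewrite [RHS]big_seq [RHS](bigID (fun k => f k \in s)) /= [X in _ = _ + X]big1 ?addr0; last first.
  by move=> k /andP[ks fk]; apply: b0.
rewrite (eq_bigr (fun k => a (f k)) (F1 := b)); last by move=> k /andP[ks fk]; rewrite ab.
rewrite -big_filter -[RHS]big_filter -[RHS](big_map f predT a).
apply: perm_big; apply: uniq_perm.
- exact: filter_uniq.
- by rewrite map_inj_uniq ?filter_uniq //; apply: can_inj fK.
move=> k; rewrite mem_filter; apply/andP/mapP => [[/andP[ks f'k] _]|[j]].
  by exists (f' k); rewrite ?f'K // mem_filter f'K ks f'k.
by rewrite mem_filter => /andP[/andP[js fj] _] ->; rewrite fK js fj.
Qed.

End PartialShift.

(** * Clusters *)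

Section ClusterLaw.
Local Open Scope classical_set_scope.
Variables (R : realType) (G : countGroupType).
Local Notation I := (G * nat)%type.
Local Notation gmul := (@monoid.mul G).
Local Notation ginv := (@monoid.inv G).
Local Notation gone := (@monoid.one G).
Variables (K : {fset I}) (u : (I -> bool) -> bool) (T N : nat).
Hypothesis du : depends_on K u.
Local Notation L := (bool * 'I_T.+1)%type.
Local Notation a0 := ((false, ord0) : L).
Implicit Types (om : I -> L) (B : set (subsetsM G)).

(** Levels are filled from the bottom, so points sending masses [w] and [w'] to a site disagree on
    only about [N * |w - w'|] of its levels. *)
Definition chosen (n : nat) (k : I) om : bool :=
  hit u om && (n < Num.truncn (N%:R * wt R K u om k))%N.

(** Viewed from [d], the site [k] is [d^-1 k]: the cluster consists of the points that use level
    [n] of the site [k]. *)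
Definition cluster (n : nat) (k : I) om : subsetsM G :=
  fun d => chosen n (gact (ginv d) k) (shift d om).

(** The root and a point [d] can use a common site only if [K] meets its translate by [d], which
    puts [d] in this set. *)
Definition spread : {fset G} := [fset gmul k.1 (ginv k'.1) | k in K, k' in K]%fset.

Definition window : {fset I} := [fset gact d i | d in spread, i in K]%fset.

Lemma chosen_out n k om : k \notin K -> chosen n k om = false.
Proof. by move=> kK; rewrite /chosen wt_out // mulr0 truncn0 ltn0 andbF. Qed.

Lemma chosen_dep n k : depends_on K (chosen n k).
Proof.
move=> om om' h; rewrite /chosen (hit_dep du h).
by rewrite (@wt_dep R G K u T k _ _ h).
Qed.

Lemma in_spread k d : k \in K -> gact (ginv d) k \in K -> d \in spread.
Proof.
move=> kK dkK; apply/imfset2P; exists k => //; exists (gact (ginv d) k) => //.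
by rewrite /gact /= invgM invgK mulVKg.
Qed.

Lemma cluster_dep n k : k \in K -> depends_on window (cluster n k).
Proof.
move=> kK om om' h; apply/funext => d; rewrite /cluster.
have [dkK|dkK] := boolP (gact (ginv d) k \in K); last by rewrite !chosen_out.
apply: chosen_dep => i iK; apply: h; apply/imfset2P; exists d; last by exists i.
exact: in_spread dkK.
Qed.

Lemma cluster1 n k om : cluster n k om gone = chosen n k om.
Proof. by rewrite /cluster invg1 gact1 shift1. Qed.

Lemma clusterM n k om g h :
  cluster n k om (gmul g h) = cluster n (gact (ginv g) k) (shift g om) h.
Proof. by rewrite /cluster invgM -gactM shiftM. Qed.

(** Summing over all levels and sites used by the root, without dividing by their number, counts
    each cluster once from each of its points. This is what makes the normalized law unimodular. *)
Definition cmass B : R := \sum_(n < N) \sum_(k <- K)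
  expect a0 window (fun om => (chosen n k om && `[< B (cluster n k om) >])%:R).

(** Up to a factor the mass counts triples of a configuration, a level and a site, so the law is
    uniform on a finite list of clusters. *)
Lemma cluster_law : 0 < cmass [set: _] ->
  exists P : probability (subsetsM G) R,
    forall B, P B = (cmass B / cmass [set: _])%:E.
Proof.
pose Om := ({ffun window -> L} * ('I_N * K))%type.
pose ch (w : Om) := chosen w.2.1 (val w.2.2) (ext a0 w.1).
pose F (w : Om) := cluster w.2.1 (val w.2.2) (ext a0 w.1).
pose s := [seq F w | w <- enum ch].
pose c : R := #|{ffun window -> L}|%:R.
have c0 : 0 < c by apply: card_configs_gt0; exact: a0.
have cE B : cmass B = c^-1 * (count (fun x => `[< B x >]) s)%:R.
  pose f (om : {ffun window -> L}) (n : 'I_N) (k : K) : R :=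
    (chosen n (val k) (ext a0 om) && `[< B (cluster n (val k) (ext a0 om)) >])%:R.
  have -> : (count (fun x => `[< B x >]) s)%:R = \sum_w f w.1 w.2.1 w.2.2.
    rewrite /s count_map -sum1_count big_enum_cond /= natr_sum big_mkcond /=.
    by apply: eq_bigr => w _; rewrite /f /ch /F unfold_in; case: (_ && _).
  rewrite -(pair_bigA _ (fun (c : {ffun window -> L}) (q : 'I_N * K) => f c q.1 q.2)) exchange_big mulr_sumr /=.
  rewrite -(pair_bigA _ (fun (n : 'I_N) (k : K) => c^-1 * \sum_(c : {ffun window -> L}) f c n k)).
  by apply: eq_bigr => n _; rewrite big_seq_fsetE.
move=> m0; have : (0 < count (fun x => `[< @setT (subsetsM G) x >]) s)%N.
  rewrite lt0n; apply: contraTneq m0 => h; by rewrite cE h mulr0 ltxx.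
case sE : s => [//|x l] _; exists (uniform_law R x l) => B.
rewrite !cE sE [uniform_law _ _ _ _]ulawE; congr EFin.
rewrite [X in _ = _ / (_ * X%:R)](_ : _ = size (x :: l)); last first.
  by rewrite (eq_count (a2 := predT)) ?count_predT // => z; apply/asboolP.
by rewrite invfM mulrACA invrK mulVf ?mul1r // gt_eqF.
Qed.

Lemma eq_cmass B B' :
  (forall n k om, chosen n k om -> B (cluster n k om) <-> B' (cluster n k om)) ->
  cmass B = cmass B'.
Proof.
move=> BB'; apply: eq_bigr => n _; apply: eq_bigr => k _; congr expect.
apply/funext => om; congr (nat_of_bool _)%:R.
by case: (boolP (chosen n k om)) => //= /BB' /asbool_equiv_eq.
Qed.

Lemma cluster_finite n k om : k \in K -> finite_set [set g | cluster n k om g].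
Proof.
move=> kK; apply: (sub_finite_set _ (finite_fset spread)) => d /= dk.
apply: (in_spread kK); apply: contraTT dk => dkK.
by rewrite /cluster chosen_out.
Qed.

(** Mass transport: moving the root to [g] replaces the site [k] by [g^-1 k] and shifts the
    labels, which preserves the sum over all sites. *)
Lemma cmass_rerooting (g : G) B :
  cmass [set E : subsetsM G | E g /\ B (fun h => E (gmul g h))] =
  cmass [set E : subsetsM G | E (ginv g) /\ B E].
Proof.
apply: eq_bigr => n _.
pose phi k (om : I -> L) : R :=
  (chosen n k om && (cluster n k om (ginv g) && `[< B (cluster n k om) >]))%:R.
have E2 k om : (chosen n k om &&
    `[< [set E : subsetsM G | E (ginv g) /\ B E] (cluster n k om) >])%:R = phi k om.
  by rewrite /phi asbool_and asboolb.
have E1 k om : (chosen n k om && `[< [set E : subsetsM G | E g /\ B (fun h => E (gmul g h))]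
    (cluster n k om) >])%:R = phi (gact (ginv g) k) (shift g om).
  rewrite /phi asbool_and asboolb.
  have -> : cluster n (gact (ginv g) k) (shift g om) (ginv g) = chosen n k om.
    by rewrite /cluster invgK gactVK shiftM mulgV shift1.
  have -> : chosen n (gact (ginv g) k) (shift g om) = cluster n k om g by [].
  have -> : (fun h => cluster n k om (gmul g h)) = cluster n (gact (ginv g) k) (shift g om).
    by apply/funext => h; rewrite clusterM.
  by move: (chosen n k om) (cluster n k om g) `[< _ >] => [] [] [].
transitivity (\sum_(k <- K) expect a0 window (fun om => phi (gact (ginv g) k) (shift g om))).
  by apply: eq_bigr => k _; congr expect; apply/funext => om; rewrite E1.
transitivity (\sum_(k <- K) expect a0 window (phi k)); last first.
  by apply: eq_bigr => k _; congr expect; apply/funext => om; rewrite E2.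
have ex0 (F : (I -> L) -> R) : (forall om, F om = 0) -> expect a0 window F = 0.
  by move=> F0; rewrite /expect big1 ?mulr0.
apply: (@sum_partial_bij _ _ _ (gact g) (gact (ginv g))).
- exact: fset_uniq.
- exact: gactK.
- exact: gactVK.
- by move=> k kK gkK; apply: ex0 => om; rewrite /phi chosen_out.
- move=> k kK gkK; apply: ex0 => om; rewrite /phi {1}/cluster invgK.
  by rewrite [chosen _ (gact g k) _]chosen_out ?andbF.
move=> k kK gkK; rewrite gactK.
have d : depends_on window (phi k).
  move=> om om' h; rewrite /phi (cluster_dep n kK h) -!cluster1.
  by rewrite (cluster_dep n kK h).
apply: (@expect_shift R I L a0 window (gact g) (phi k) (@gact_inj G g) d).
move=> om om' h.
have e := E1 (gact g k) om; have e' := E1 (gact g k) om'; rewrite gactK in e e'.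
change (phi k (shift g om) = phi k (shift g om')).
by rewrite -e -e' -!cluster1 (cluster_dep n gkK h).
Qed.

End ClusterLaw.

Section Counting.

Lemma sum_ltn (N t : nat) : (\sum_(n < N) (n < t) = minn N t)%N.
Proof.
elim: N => [|N IH]; first by rewrite big_ord0 min0n.
rewrite big_ord_recr /= IH; case: ltnP; lia.
Qed.

Lemma sum_between (N t t' : nat) : (\sum_(n < N) ((n < t) && ~~ (n < t')) <= t - t')%N.
Proof.
suff : (\sum_(n < N) ((n < t) && ~~ (n < t')) <= minn N t - minn N t')%N by move=> h; apply: leq_trans h _; lia.
elim: N => [|N IH]; first by rewrite big_ord0.
rewrite big_ord_recr /=; move: IH; set s := bigop _ _ _.
by case: (ltnP N t) => ?; case: (ltnP N t') => ? /=; lia.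
Qed.

Variable R : archiRealFieldType.

Lemma truncn_close (x : R) : 0 <= x -> `|(Num.truncn x)%:R - x| <= 1.
Proof.
move=> x0; have /andP[h1 h2] := Num.Theory.truncn_itv x0.
by move: h2; rewrite -natr1 ler_norml => h2; apply/andP; split; lra.
Qed.

Lemma truncn_sub (x y : R) : 0 <= x -> 0 <= y ->
  (Num.truncn x - Num.truncn y)%:R <= `|x - y| + 1.
Proof.
move=> x0 y0; have /andP[h1 _] := Num.Theory.truncn_itv x0.
have /andP[_ h2] := Num.Theory.truncn_itv y0.
have h3 := ler_norm (x - y).
have [le|lt] := leqP (Num.truncn x) (Num.truncn y).
  by move: le; rewrite -subn_eq0 => /eqP ->; rewrite addr_ge0.
rewrite natrB ?(ltnW lt) //; move: h2; rewrite -natr1; lra.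
Qed.

End Counting.

Section ClusterClose.
Local Open Scope classical_set_scope.
Variables (R : realType) (G : countGroupType).
Local Notation I := (G * nat)%type.
Local Notation ginv := (@monoid.inv G).
Variables (K : {fset I}) (u : (I -> bool) -> bool) (T N : nat).
Hypothesis N0 : (0 < N)%N.
Local Notation L := (bool * 'I_T.+1)%type.
Implicit Types (om : I -> L).

Definition pattern (S : seq G) (E0 : G -> bool) : set (subsetsM G) :=
  [set E : subsetsM G | forall g, g \in S -> E g = E0 g].

Definition hit_pattern (S : seq G) (E0 : G -> bool) (v : (I -> bool) -> bool) (y : I -> bool) : bool :=
  v y && all (fun g => v (shift g y) == E0 g) S.

Local Notation w := (wt R K u).

Lemma sum_wt om : total_wt R K u om = 0 \/ total_wt R K u om = 1.
Proof.
rewrite /total_wt.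
have -> : \sum_(k : K) w om (val k) = \sum_k weight R (uK u) (fun k' : K => times om (val k')) k
    [ffun k' : K => bits om (val k')].
  by apply: eq_bigr => k _; rewrite /wt valK.
by rewrite sum_weight; case: (_ != _); [right|left].
Qed.

Lemma wt_le1 om (k : K) : w om (val k) <= 1.
Proof.
have h : w om (val k) <= total_wt R K u om.
  by rewrite /total_wt (bigD1 k) //= lerDl sumr_ge0 // => i _; apply: wt_ge0.
by apply: le_trans h _; case: (sum_wt om) => ->.
Qed.

Lemma sum_chosen om (k : K) : hit u om ->
  \sum_(n < N) (chosen R K u N n (val k) om)%:R = (Num.truncn (N%:R * w om (val k)))%:R :> R.
Proof.
move=> h; rewrite -natr_sum; congr (_%:R).
rewrite (eq_bigr (fun n : 'I_N => (n < Num.truncn (N%:R * w om (val k))) : nat)%N).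
  rewrite sum_ltn; apply/minn_idPr; rewrite -(@ler_nat R).
  have x0 : 0 <= N%:R * w om (val k) by rewrite mulr_ge0 ?wt_ge0.
  have /andP[h1 _] := Num.Theory.truncn_itv x0.
  by apply: le_trans h1 _; rewrite ler_piMr // wt_le1.
by move=> n _; rewrite /chosen h.
Qed.

(** If [g] is not hit, no cluster contains it and there is no error. If it is, the errors are the
    levels used by the root but not by [g]; the [1] is due to rounding. *)
Lemma sum_chosen_miss om (k : K) (g : G) : hit u om ->
  \sum_(n < N) (chosen R K u N n (val k) om &&
     (cluster R K u N n (val k) om g != hit u (shift g om)))%:R <=
  (hit u (shift g om))%:R * (N%:R * `|w om (val k) - w (shift g om) (gact (ginv g) (val k))|) + 1 :> R.
Proof.
move=> h; rewrite /cluster /chosen h.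
case: (hit u (shift g om)) => /=; last first.
  by rewrite big1 ?mul0r ?add0r // => n _; rewrite ?andbF.
rewrite mul1r -natr_sum.
apply: (@le_trans _ _ (Num.truncn (N%:R * w om (val k)) -
    Num.truncn (N%:R * w (shift g om) (gact (ginv g) (val k))))%:R).
  rewrite ler_nat; apply: leq_trans (sum_between N _ _).
  by apply: leq_sum => n _; rewrite eqb_id.
apply: le_trans (truncn_sub _ _) _; rewrite ?mulr_ge0 ?wt_ge0 //.
by rewrite -mulrBr normrM ger0_norm.
Qed.

(** Three errors occur: roots of energy [0], rounding, and levels on which the root and some [g] of
    [S] disagree. Rounding is charged once per [g] and once for the total mass, whence
    [(size S).+1]. *)
Lemma cluster_pattern_pointwise om (S : seq G) (E0 : G -> bool) :
  `|N%:R^-1 * \sum_(n < N) \sum_(k : K) (chosen R K u N n (val k) om &&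
       `[< pattern S E0 (cluster R K u N n (val k) om) >])%:R
    - (hit u om && all (fun g => hit u (shift g om) == E0 g) S)%:R| <=
  (hit u om && (total_wt R K u om == 0))%:R +
  #|{: K}|%:R / N%:R * (size S).+1%:R * (hit u om)%:R +
  \sum_(g <- S) (hit u om && hit u (shift g om))%:R *
     \sum_(k : K) `|w om (val k) - w (shift g om) (gact (ginv g) (val k))|.
Proof.
have Np : 0 < N%:R :> R by rewrite ltr0n.
case h : (hit u om); last first.
  rewrite big1 => [|n _]; last by rewrite big1 // => k _; rewrite /chosen h.
  rewrite /= mulr0 subrr normr0 mulr0 !add0r; apply: sumr_ge0 => g _.
  by rewrite mul0r.
rewrite /= mulr1; set pat := all _ _.
(* [Z] is the mass sent by the root after rounding down to multiples of [1 / N]; it is nearly [1]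
   unless the energy is [0]. *)
pose Z : R := N%:R^-1 * \sum_(k : K) (Num.truncn (N%:R * w om (val k)))%:R.
have ZE : Z = N%:R^-1 * \sum_(n < N) \sum_(k : K) (chosen R K u N n (val k) om)%:R.
  by rewrite exchange_big /=; congr (_ * _); apply: eq_bigr => k _; rewrite sum_chosen.
have Z1 : `|Z - 1| <= (total_wt R K u om == 0)%:R + #|{: K}|%:R / N%:R.
  have h1 : `|Z - total_wt R K u om| <= #|{: K}|%:R / N%:R.
    rewrite /Z /total_wt mulr_sumr -sumrB; apply: le_trans (ler_norm_sum _ _ _) _.
    rewrite -[X in X%:R / _]sum1_card natr_sum mulr_suml; apply: ler_sum => k _.
    have x0 : 0 <= N%:R * w om (val k) by rewrite mulr_ge0 ?wt_ge0.
    have -> : w om (val k) = N%:R^-1 * (N%:R * w om (val k)) by rewrite mulKf ?gt_eqF.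
    rewrite -mulrBr normrM ger0_norm ?invr_ge0 // mul1r ler_piMr ?invr_ge0 //.
    by rewrite mulKf ?gt_eqF //; apply: truncn_close.
  move: h1; case: (sum_wt om) => ->; rewrite ?eqxx ?oner_eq0 /=; last by rewrite add0r.
  rewrite subr0 => h1; apply: le_trans (ler_normB _ _) _.
  by rewrite normr1 addrC lerD2l.
(* [Y] tests the pattern of the hit points instead of that of the cluster, so [X - Y] involves only
   levels and sites whose cluster errs somewhere on [S]. *)
pose Y : R := N%:R^-1 * \sum_(n < N) \sum_(k : K) (chosen R K u N n (val k) om && pat)%:R.
have YZ : Y = Z * pat%:R.
  rewrite ZE -mulrA; congr (_ * _); rewrite mulr_suml; apply: eq_bigr => n _.
  by rewrite mulr_suml; apply: eq_bigr => k _; rewrite -natrM mulnb.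
set X := _ * _; have -> : X - pat%:R = (X - Y) + (Z - 1) * pat%:R by rewrite YZ; ring.
apply: le_trans (ler_normD _ _) _.
have h2 : `|(Z - 1) * pat%:R| <= `|Z - 1|.
  by case: (pat); rewrite ?mulr1 // mulr0 normr0.
have h3 : `|X - Y| <= \sum_(g <- S) ((hit u (shift g om))%:R *
     \sum_(k : K) `|w om (val k) - w (shift g om) (gact (ginv g) (val k))| + #|{: K}|%:R / N%:R).
  apply: (@le_trans _ _ (\sum_(g <- S) N%:R^-1 * \sum_(k : K) \sum_(n < N)
     (chosen R K u N n (val k) om && (cluster R K u N n (val k) om g != hit u (shift g om)))%:R)).
    rewrite -mulr_sumr /X /Y -mulrBr normrM ger0_norm ?invr_ge0 //.
    apply: ler_wpM2l; first by rewrite invr_ge0.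
    rewrite -sumrB [leRHS](eq_bigr (fun g => \sum_(n < N) \sum_(k : K)
     (chosen R K u N n (val k) om && (cluster R K u N n (val k) om g != hit u (shift g om)))%:R)); last first.
      by move=> g _; rewrite exchange_big.
    rewrite exchange_big /=; apply: le_trans (ler_norm_sum _ _ _) _; apply: ler_sum => n _.
    rewrite -sumrB exchange_big /=; apply: le_trans (ler_norm_sum _ _ _) _; apply: ler_sum => k _.
    case: (chosen _ _ _ _ _ _ _) => /=; last by rewrite subrr normr0 sumr_ge0.
    set E := cluster _ _ _ _ _ _ _.
    have [/hasP[g gS Eg]|/hasPn same] := boolP (has (fun g => E g != hit u (shift g om)) S).
      rewrite (big_rem g) //= Eg; apply: (@le_trans _ _ 1); last by rewrite lerDl sumr_ge0.
      by case: `[< _ >]; case: (pat) => /=; rewrite ?(subr0, sub0r, subrr, normrN, normr1, normr0).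
    have -> : `[< pattern S E0 E >] = pat.
      apply: asbool_equiv_eqP; first exact: allP.
      have Eh g : g \in S -> E g = hit u (shift g om).
        by move=> /same; rewrite negbK => /eqP.
      by split=> hE g gS; [rewrite -(Eh g gS) (hE g gS)|rewrite (Eh g gS); apply/eqP/hE].
    by rewrite subrr normr0 sumr_ge0.
  apply: ler_sum => g _.
  apply: (@le_trans _ _ (N%:R^-1 * \sum_(k : K) ((hit u (shift g om))%:R *
     (N%:R * `|w om (val k) - w (shift g om) (gact (ginv g) (val k))|) + 1))).
    apply: ler_wpM2l; first by rewrite invr_ge0.
    by apply: ler_sum => k _; apply: sum_chosen_miss.
  rewrite big_split /= sumr_const mulrDr -[X in _ + _ * X]/(#|{: K}|%:R) [X in _ + X]mulrC.
  rewrite lerD2r -mulr_sumr -mulr_sumr mulrCA mulKf ?gt_eqF //.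
rewrite big_split /= in h3.
have h4 : \sum_(g <- S) #|{: K}|%:R / N%:R = #|{: K}|%:R / N%:R * (size S)%:R :> R.
  by rewrite big_const_seq count_predT iter_addr_0 mulr_natr.
rewrite h4 in h3; rewrite -natr1 mulrDr mulr1.
apply: le_trans (lerD h3 (le_trans h2 Z1)) _.
lra.
Qed.

End ClusterClose.

Section ClusterApprox.
Local Open Scope classical_set_scope.
Variables (R : realType) (G : countGroupType).
Local Notation I := (G * nat)%type.
Local Notation ginv := (@monoid.inv G).

Section Fixed.
Variables (K : {fset I}) (u : (I -> bool) -> bool) (T N : nat).
Hypothesis du : depends_on K u.
Hypothesis N0 : (0 < N)%N.
Local Notation L := (bool * 'I_T.+1)%type.
Local Notation a0 := ((false, ord0) : L).
Local Notation p := (prob_ev R K u).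
Local Notation mass_of := (@cmass R G K u T N).

Lemma cluster_law_unimodular (P : probability (subsetsM G) R) :
  0 < mass_of setT -> (forall B, P B = (mass_of B / mass_of setT)%:E) ->
  unimodular P /\ finitely_supported P.
Proof.
move=> m0 PE; have one B : (forall n k (om : I -> L), chosen R K u N n k om ->
    B (cluster R K u N n k om)) -> P B = 1%E.
  move=> h; rewrite PE (_ : mass_of B = mass_of setT) ?divff ?gt_eqF //.
  by apply: eq_cmass => n k om /h.
split; [split|].
- by apply: one => n k om ch; rewrite /Mo /= cluster1.
- by move=> g B _; rewrite !PE cmass_rerooting.
apply: one => n k om ch; apply: (@cluster_finite R G K u T N).
by apply: contraTT ch => kK; rewrite chosen_out.
Qed.

Lemma cmass_expect (J : {fset I}) B : (window K `<=` J)%fset ->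
  N%:R^-1 * mass_of B = expect a0 J (fun om => N%:R^-1 * \sum_(n < N) \sum_(k : K)
    (chosen R K u N n (val k) om && `[< B (cluster R K u N n (val k) om) >])%:R).
Proof.
move=> KJ; rewrite expectZ expect_sum; congr (_ * _); apply: eq_bigr => n _.
rewrite expect_sum big_seq_fsetE; apply: eq_bigr => k _.
apply/esym/expect_sub; last exact: KJ.
by move=> om om' h; rewrite -!cluster1 (cluster_dep R N du n (fsvalP k) h).
Qed.

Lemma expect_close (J : {fset I}) (phi psi rho : (I -> L) -> R) :
  (forall om, `|phi om - psi om| <= rho om) ->
  `|expect a0 J phi - expect a0 J psi| <= expect a0 J rho.
Proof.
move=> h; rewrite /expect -mulrBr -sumrB normrM ger0_norm ?invr_ge0 //.
apply: ler_wpM2l; first by rewrite invr_ge0.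
by apply: le_trans (ler_norm_sum _ _ _) _; apply: ler_sum => c _; apply: h.
Qed.

Lemma expect_bits (J : {fset I}) (phi : (I -> bool) -> R) :
  expect a0 J (fun om => phi (bits om)) = expect false J phi.
Proof.
rewrite expect_pair; set q := RHS; rewrite (eq_bigr (fun=> q)) => [|t _].
  rewrite sumr_const -[q *+ _]mulr_natr mulrCA mulVf ?mulr1 // gt_eqF //.
  by apply: card_configs_gt0; exact: ord0.
congr (_ * _); apply: eq_bigr => y _; congr phi; apply/funext => i.
by rewrite /bits /ext; case: insubP => // j _ _; rewrite ffunE.
Qed.

Lemma cmass_bounds B : 0 <= mass_of B <= mass_of setT.
Proof.
apply/andP; split.
  apply: sumr_ge0 => n _; apply: sumr_ge0 => k _.
  by rewrite mulr_ge0 ?invr_ge0 // sumr_ge0.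
apply: ler_sum => n _; apply: ler_sum => k _; apply: expect_le => om.
rewrite ler_nat; case: (chosen _ _ _ _ _ _ _) => //=.
by rewrite [X in (_ <= nat_of_bool X)%N]asboolT // leq_b1.
Qed.

Definition close_bound (s : nat) (th B e : R) : R :=
  (p + e) + #|{: K}|%:R / N%:R * s.+1%:R +
  s%:R * (2 * th + 64 * (1 + th^-1) / B + 2 * expR B * p + 2 * e).

Lemma cmass_close (J : {fset I}) (S : seq G) (E0 : G -> bool) (th B e : R) :
  0 < th -> 0 < B -> 0 < e -> (window K `<=` J)%fset -> (K `<=` J)%fset ->
  {in S, forall g, {in K, forall i, gact g i \in J}} ->
  (forall J' : finType, (#|J'| <= #|{: J}|)%N ->
    #|[pred t : {ffun J' -> 'I_T.+1} | ~~ injectiveb t]|%:R <=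
    e * #|{ffun J' -> 'I_T.+1}|%:R) ->
  `|N%:R^-1 * mass_of (pattern S E0) -
    expect false J (fun y => (hit_pattern S E0 u y)%:R)| <= close_bound (size S) th B e * p.
Proof.
move=> th0 B0 e0 WJ KJ SJ ties; rewrite (cmass_expect _ WJ) -expect_bits.
pose rho (om : I -> L) : R :=
  (hit u om && (total_wt R K u om == 0))%:R +
  #|{: K}|%:R / N%:R * (size S).+1%:R * (hit u om)%:R +
  \sum_(g <- S) (hit u om && hit u (shift g om))%:R *
     \sum_(k : K) `|wt R K u om (val k) - wt R K u (shift g om) (gact (ginv g) (val k))|.
apply: (@le_trans _ _ (expect a0 J rho)).
  by apply: expect_close => om; apply: cluster_pattern_pointwise.
rewrite expectD expectD expectZ expect_sum (expect_hit R T du KJ).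
rewrite /close_bound 2!(mulrDl _ _ p); apply: lerD; first apply: lerD.
- have -> : expect a0 J (fun om => (hit u om && (total_wt R K u om == 0))%:R) =
      expect a0 K (fun om => (hit u om && (total_wt R K u om == 0))%:R) :> R.
    apply: expect_sub; last exact: KJ.
    move=> om om' h; have e1 : hit u om = hit u om' := hit_dep du h.
    by cbv beta; rewrite e1 (total_wt_dep R u h).
  by apply: (expect_defect du); apply: ties; rewrite -!cardfE fsubset_leq_card.
- exact: lexx.
set C := 2 * th + _ + _ + _.
have -> : (size S)%:R * C * p = \sum_(g <- S) C * p.
  by rewrite big_const_seq count_predT iter_addr_0 -mulrA mulr_natl.
rewrite big_seq [leRHS]big_seq; apply: ler_sum => g gS.
by apply: (expect_wt_sub du th0 B0 _ KJ); [apply: ties|apply: SJ].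
Qed.

End Fixed.

(** The order of choices matters: [ep], [B] and [p0] come from [S] and [eta] alone, [T] and [N] only
    after [K] and [J] are known. *)
Lemma cluster_approx (S : seq G) (eta : R) : 0 < eta -> eta <= 1 ->
  exists2 p0 : R, 0 < p0 &
  forall (K J : {fset I}) (u : (I -> bool) -> bool), depends_on K u ->
    (K `<=` J)%fset -> {in S, forall g, {in K, forall i, gact g i \in J}} ->
    0 < prob_ev R K u <= p0 ->
  exists P : probability (subsetsM G) R, [/\ unimodular P, finitely_supported P &
    forall E0 : G -> bool, `|fine (P (pattern S E0)) -
      expect false J (fun y => (hit_pattern S E0 u y)%:R) / prob_ev R K u| <= eta].
Proof.
move=> eta0 eta1.
(* With all small parameters equal to [ep], the terms of [close_bound] add up to at most
   [10 * ep * s], which is below [eta / 3] thanks to the factor [32]. *)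
pose s : R := (size S).+1%:R; pose ep : R := eta / (32 * s).
have s1 : 1 <= s by rewrite ler1n.
have s0 : 0 < s by rewrite ltr0n.
have ep0 : 0 < ep by rewrite divr_gt0 // mulr_gt0.
have epi0 : 0 < ep^-1 by rewrite invr_gt0.
have eps : ep * (32 * s) = eta by rewrite /ep mulfVK // gt_eqF // mulr_gt0.
pose c : R := 64 * (1 + ep^-1); pose B : R := c / ep.
have c0 : 0 < c by rewrite mulr_gt0 // ltr_pwDl // ltW.
have B0 : 0 < B by rewrite divr_gt0.
have BE : c / B = ep by rewrite /B invf_div mulrCA divff ?mulr1 // gt_eqF.
exists (ep / expR B); first by rewrite divr_gt0 ?expR_gt0.
move=> K J u du KJ SJ /andP[]; set p := prob_ev R K u => p0 pp0.
have pB : expR B * p <= ep by rewrite mulrC -ler_pdivlMr ?expR_gt0.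
have pe : p <= ep.
  by apply: le_trans pB; rewrite ler_peMl ?(ltW p0) // -expR0 ler_expR ltW.
pose J1 := (J `|` window K)%fset.
have [T ties] := @few_ties R #|{: J1}| ep ep0.
pose N := (Num.truncn (#|{: K}|%:R / ep)).+1.
have N0 : (0 < N)%N by [].
have KN : #|{: K}|%:R / N%:R <= ep.
  rewrite ler_pdivrMr ?ltr0n // mulrC -ler_pdivrMr //.
  by have /andP[_ /ltW] := Num.Theory.truncn_itv (x := #|{: K}|%:R / ep)
    (divr_ge0 (ler0n _ _) (ltW ep0)).
have WJ1 : (window K `<=` J1)%fset by rewrite fsubsetUr.
have JJ1 : (J `<=` J1)%fset by rewrite fsubsetUl.
have KJ1 : (K `<=` J1)%fset := fsubset_trans KJ JJ1.
have SJ1 : {in S, forall g, {in K, forall i, gact g i \in J1}}.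
  by move=> g gS i iK; apply: (fsubsetP JJ1); apply: SJ.
have sub0 : {in [::], forall g : G, {in K, forall i, gact g i \in J1}} by [].
pose m B' := N%:R^-1 * @cmass R G K u T N B'.
have bound (n : nat) : n.+1%:R <= s -> close_bound K u N n ep B ep <= eta / 3.
  move=> ns; rewrite /close_bound -/c BE -/p.
  have n0 : 0 <= n%:R :> R by [].
  have h1 : #|{: K}|%:R / N%:R * n.+1%:R <= ep * s.
    by apply: ler_pM => //; rewrite divr_ge0.
  have h2 : 2 * ep + ep + 2 * expR B * p + 2 * ep <= 7 * ep by rewrite -mulrA; lra.
  have h3 : n%:R * (2 * ep + ep + 2 * expR B * p + 2 * ep) <= s * (7 * ep).
    apply: ler_pM => //; last by move: ns; rewrite -natr1; lra.
    have : 0 <= expR B * p by rewrite mulr_ge0 ?expR_ge0 // ltW.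
    rewrite -mulrA; lra.
  have h4 : ep <= ep * s by rewrite ler_peMr // ltW.
  rewrite -eps; move: h1 h3 h4 pe; rewrite -/p; lra.
have close S' E0 : (size S' <= size S)%N ->
    {in S', forall g, {in K, forall i, gact g i \in J1}} ->
    `|m (pattern S' E0) - expect false J1 (fun y => (hit_pattern S' E0 u y)%:R)| <= eta / 3 * p.
  move=> sS' SJ'; apply: le_trans (cmass_close du N0 E0 ep0 B0 ep0 WJ1 KJ1 SJ' ties) _.
  by rewrite ler_wpM2r ?(ltW p0) // bound // /s ler_nat ltnS.
(* The empty pattern yields the normalizing mass; [eta <= 1] then keeps it positive. *)
have mT : `|m setT - p| <= eta / 3 * p.
  have := close [::] xpredT isT sub0.
  have -> : m (pattern [::] xpredT) = m setT.
    by rewrite /m; congr (_ * _); apply: eq_cmass.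
  suff -> : expect false J1 (fun y => (hit_pattern [::] xpredT u y)%:R) = p by [].
  rewrite /p /prob_ev -(@expect_sub R I bool false K J1 _ _ KJ1).
    by congr expect; apply/funext => y; rewrite /hit_pattern andbT.
  by move=> y y' h; rewrite (du _ _ h).
have mT0 : 0 < m setT.
  have : eta / 3 * p < p by rewrite gtr_pMl //; lra.
  by move: mT; rewrite ler_norml => /andP[]; lra.
have cT0 : 0 < @cmass R G K u T N setT.
  by move: mT0; rewrite /m pmulr_rgt0 // invr_gt0 ltr0n.
have [P PE] := cluster_law cT0; exists P.
have [PU PF] := cluster_law_unimodular du cT0 PE; split=> // E0.
have := close S E0 (leqnn _) SJ1.
rewrite (@expect_sub R I bool false J J1 _ _ JJ1); last first.
  move=> y y' h; rewrite /hit_pattern (du _ _ (fun i iK => h i (fsubsetP KJ i iK))).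
  congr (nat_of_bool (_ && _))%:R; apply: eq_in_all => g gS.
  by rewrite (du _ (shift g y') (fun i iK => h _ (SJ g gS i iK))).
set H := expect _ _ _ => mH.
have -> : fine (P (pattern S E0)) = m (pattern S E0) / m setT.
  by rewrite PE /m invfM mulrACA divff ?mul1r // invr_eq0 pnatr_eq0.
set b := m _ in mH *; set z := m setT in mT mT0 *.
have bz : 0 <= b <= z.
  have /andP[h1 h2] := cmass_bounds K u T N (pattern S E0).
  have Ni : 0 <= N%:R^-1 :> R by rewrite invr_ge0.
  by rewrite /b /z /m mulr_ge0 //= ler_wpM2l.
have -> : b / z - H / p = (b - H) / p + b / z * ((p - z) / p).
  by field; rewrite !gt_eqF.
apply: le_trans (ler_normD _ _) _.
have h1 : `|(b - H) / p| <= eta / 3.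
  by rewrite normrM (gtr0_norm (x := p^-1)) ?invr_gt0 // ler_pdivrMr.
have h2 : `|b / z * ((p - z) / p)| <= eta / 3.
  rewrite normrM -[leRHS]mul1r; apply: ler_pM => //.
    rewrite ger0_norm ?divr_ge0 ?(ltW mT0) //; last by case/andP: bz.
    by rewrite ler_pdivrMr // mul1r; case/andP: bz.
  by rewrite normrM (gtr0_norm (x := p^-1)) ?invr_gt0 // ler_pdivrMr // distrC.
lra.
Qed.

End ClusterApprox.

(** * Binary digits of iid uniform labels *)

Section Bits.
Local Open Scope classical_set_scope.
Variable R : realType.

Definition bit (j : nat) (r : R) : bool := odd (Num.truncn (2 ^+ j.+1 * r)).

Lemma truncn_double (x : R) : Num.truncn x = (Num.truncn (2 * x))./2.
Proof.
have [x0|x0] := leP 0 x; last first.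
  by rewrite !truncn_floor !leNgt pmulr_rlt0 // x0.
have x20 : 0 <= 2 * x by rewrite mulr_ge0.
have /andP[h1 h2] := Num.Theory.truncn_itv x20.
apply: Num.Theory.truncn_def; set n := Num.truncn (2 * x) in h1 h2 *.
have nE := odd_double_half n.
have h3 : (n./2 + n./2 <= n)%N by rewrite addnn; lia.
have h4 : (n.+1 <= (n./2).+1 + (n./2).+1)%N by move: nE; case: (odd n) => /=; lia.
move: h3 h4; rewrite -(@ler_nat R) -[(n.+1 <= _)%N](@ler_nat R) !natrD => h3 h4.
apply/andP; split; lra.
Qed.

Lemma truncnS m (r : R) : Num.truncn (2 ^+ m * r) = (Num.truncn (2 ^+ m.+1 * r))./2.
Proof. by rewrite exprS -mulrA -truncn_double. Qed.

Lemma bits_truncn (m : nat) (c : nat -> bool) : exists2 a : nat, (a < 2 ^ m)%N &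
  forall r : R, 0 <= r < 1 ->
    (forall j, (j < m)%N -> bit j r = c j) <-> Num.truncn (2 ^+ m * r) = a.
Proof.
elim: m => [|m [a am IH]].
  exists 0%N => // r /andP[r0 r1]; split=> // _; rewrite expr0 mul1r.
  by apply: Num.Theory.truncn_def; rewrite r0.
exists (c m + a.*2)%N.
  by rewrite expnS mul2n -addnn; move: am; case: (c m); lia.
move=> r r01; have := IH r r01; rewrite truncnS => {}IH.
have tE := odd_double_half (Num.truncn (2 ^+ m.+1 * r)).
split=> [h|h].
  rewrite -tE -/(bit m r) h // (proj1 IH) // => j jm.
  by apply: h; rewrite ltnS ltnW.
have ta : (Num.truncn (2 ^+ m.+1 * r))./2 = a by rewrite h half_bit_double.
have tc : bit m r = c m by rewrite /bit h oddD odd_double addbF oddb.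
move=> j; rewrite ltnS leq_eqVlt => /orP[/eqP -> //|jm].
exact: (proj2 IH ta).
Qed.

Fixpoint dyadic (b : nat -> bool) (m : nat) : nat :=
  if m is m'.+1 then (b m' + (dyadic b m').*2)%N else 0%N.

Lemma dyadic_bits (m : nat) (r : R) : 0 <= r < 1 ->
  dyadic (bit ^~ r) m = Num.truncn (2 ^+ m * r).
Proof.
move=> /andP[r0 r1]; elim: m => [|m IH] /=.
  by rewrite expr0 mul1r; apply/esym/Num.Theory.truncn_def; rewrite r0.
by rewrite IH truncnS odd_double_half.
Qed.

Lemma measurable_bit j : measurable [set r : R | bit j r].
Proof.
have p0 : 0 < 2 ^+ j.+1 :> R by rewrite exprn_gt0.
have le n : measurable [set r : R | (Num.truncn (2 ^+ j.+1 * r) <= n)%N].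
  rewrite (_ : [set _ | _] = `]-oo, (n.+1%:R / 2 ^+ j.+1)[) //.
  apply/seteqP; split=> r /=; rewrite in_itv /= truncn_le_nat ltr_pdivlMr // mulrC //.
have eq n : measurable [set r : R | Num.truncn (2 ^+ j.+1 * r) = n].
  case: n => [|n].
    rewrite (_ : [set _ | _] = [set r : R | (Num.truncn (2 ^+ j.+1 * r) <= 0)%N]) //.
    by apply/seteqP; split=> r /=; rewrite leqn0 => /eqP.
  rewrite (_ : [set _ | _] = [set r : R | (Num.truncn (2 ^+ j.+1 * r) <= n.+1)%N] `\`
    [set r : R | (Num.truncn (2 ^+ j.+1 * r) <= n)%N]); first exact: measurableD.
  apply/seteqP; split=> r /= => [->|[h1 /negP]]; first by split=> //; rewrite ltnn.
  by rewrite -ltnNge => h2; apply/eqP; rewrite eqn_leq h1 h2.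
rewrite (_ : [set _ | _] = \bigcup_(n in [set n | odd n]) [set r : R | Num.truncn (2 ^+ j.+1 * r) = n]).
  exact: bigcup_measurable.
apply/seteqP; split=> r /= => [h|[n /= h e]]; last by rewrite /bit e.
by exists (Num.truncn (2 ^+ j.+1 * r)).
Qed.

Lemma measurable_bits (m : nat) (c : nat -> bool) :
  measurable [set r : R | forall j, (j < m)%N -> bit j r = c j].
Proof.
rewrite (_ : [set _ | _] = \bigcap_(j in [set j | (j < m)%N]) [set r : R | bit j r = c j]) //.
apply: bigcap_measurableType => j _.
case: (c j); first exact: measurable_bit.
rewrite (_ : [set _ | _] = ~` [set r : R | bit j r]); first by apply: measurableC; apply: measurable_bit.
by apply/seteqP; split=> r /= => [->|/negP/negbTE].
Qed.

(** The point [1], whose digits all read [0], is a null set of the closed interval. *)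
Lemma lebesgue_bits (m : nat) (c : nat -> bool) :
  lebesgue_measure ([set r : R | forall j, (j < m)%N -> bit j r = c j] `&` `[0, 1]) =
  (2^-1 ^+ m)%:E.
Proof.
have [a am ha] := bits_truncn m c; set A := [set r | _].
have p0 : 0 < 2 ^+ m :> R by rewrite exprn_gt0.
have E : A `&` `[0, 1] = `[a%:R / 2 ^+ m, a.+1%:R / 2 ^+ m[ `|` (A `&` [set 1]).
  have cell (r : R) : 0 <= r < 1 -> A r <-> (a%:R / 2 ^+ m <= r < a.+1%:R / 2 ^+ m).
    move=> r01; rewrite -[A r]/(forall j, (j < m)%N -> bit j r = c j) (ha r r01).
    have r0 : 0 <= 2 ^+ m * r by rewrite mulr_ge0 ?(ltW p0) //; case/andP: r01.
    rewrite ler_pdivrMr // ltr_pdivlMr // ![r * _]mulrC -truncn_eq //.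
    by split=> /eqP.
  have r01 (r : R) : a%:R / 2 ^+ m <= r < a.+1%:R / 2 ^+ m -> 0 <= r < 1.
    move=> /andP[h1 h2]; apply/andP; split; first by apply: le_trans h1; rewrite divr_ge0 // ltW.
    by apply: lt_le_trans h2 _; rewrite ler_pdivrMr // mul1r -natrX ler_nat.
  apply/seteqP; split=> r /=; rewrite !in_itv /=.
    move=> [Ar /andP[r0 r1]]; move: r1; rewrite le_eqVlt => /orP[/eqP r1|r1]; first by right.
    by left; apply/(cell r) => //; rewrite r0 r1.
  move=> [h|[Ar r1]]; last by split=> //; rewrite r1 ler01 lexx.
  have r01' := r01 r h; split; first exact/(cell r r01').
  by move: r01' => /andP[-> /ltW ->].
have mA : measurable (A `&` [set 1]) by apply: measurableI => //; apply: measurable_bits.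
have A0 : lebesgue_measure (A `&` [set 1]) = 0%E.
  apply: (subset_measure0 _ _ _ (lebesgue_measure_set1 1)) => //; exact: subIsetr.
rewrite E measureU0 //.
apply: etrans (lebesgue_measure_itv _) _; rewrite /= lte_fin ltr_pM2r ?invr_gt0 // ltr_nat ltnSn.
by rewrite -EFinB -mulrBl -natrB // subSnn mul1r exprVn.
Qed.

End Bits.

Section FiniteUnion.
Local Open Scope classical_set_scope.

Lemma measure_finite_union (d : measure_display) (X : measurableType d) (R : realType)
    (mu : {measure set X -> \bar R}) (C : finType) (F : C -> set X) :
  (forall c, measurable (F c)) -> (forall c c' x, F c x -> F c' x -> c = c') ->
  mu [set x | exists c, F c x] = (\sum_c mu (F c))%E.
Proof.
move=> mF dF.
have H (s : seq C) : uniq s -> measurable [set x | exists2 c, c \in s & F c x] /\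
    mu [set x | exists2 c, c \in s & F c x] = (\sum_(c <- s) mu (F c))%E.
  elim: s => [_|c s IH /= /andP[cs us]].
    rewrite (_ : [set x | _] = set0); first by rewrite big_nil measure0.
    by apply/seteqP; split=> x //= [].
  have [mS muS] := IH us.
  rewrite (_ : [set x | _] = F c `|` [set x | exists2 c, c \in s & F c x]); last first.
    apply/seteqP; split=> x /=.
      by move=> [c']; rewrite inE => /orP[/eqP ->|c's] Fx; [left|right; exists c'].
    move=> [Fx|[c' c's Fx]]; [exists c|exists c'] => //; rewrite inE ?eqxx //.
    by rewrite c's orbT.
  split; first exact: measurableU.
  rewrite big_cons -muS measureU //.
  apply/seteqP; split=> x //= [Fx [c' c's F'x]].
  by move: cs; rewrite (dF _ _ _ Fx F'x) c's.
have [_ <-] := H _ (index_enum_uniq C); congr (mu _).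
by apply/seteqP; split=> x /= [c]; [exists c => //; rewrite mem_index_enum|move=> _; exists c].
Qed.

End FiniteUnion.

Section BernoulliBits.
Local Open Scope classical_set_scope.
Variables (R : realType) (G : countGroupType).
Local Notation I := (G * nat)%type.
Local Notation ginv := (@monoid.inv G).
Local Notation Om := (bshift_space R G).

Definition bits_of (x : Om) : I -> bool := fun i => bit i.2 (x i.1).

Lemma shift_bits_of g x : shift g (bits_of x) = bits_of (bshift (ginv g) x).
Proof. by apply/funext => i; rewrite /shift /bits_of /bshift /gact /= invgK. Qed.

Lemma measurable_coord (g : G) (B : set R) : measurable B ->
  measurable [set x : Om | B (x g)].
Proof. by move=> mB; apply: sub_sigma_algebra; exists g, B. Qed.

Lemma measurable_pattern (J : {fset I}) (c : {ffun J -> bool}) :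
  measurable [set x : Om | forall j : J, bits_of x (val j) = c j].
Proof.
rewrite (_ : [set x | _] = \bigcap_(j in [set: J]) [set x : Om | bits_of x (val j) = c j]); last first.
  by apply/seteqP; split=> x /= h j; [move=> _|]; apply: h.
apply: fin_bigcap_measurable => // j _.
rewrite (_ : [set x | _] = [set x : Om | [set r : R | bit (val j).2 r = c j] (x (val j).1)]) //.
apply: measurable_coord; case: (c j); first exact: measurable_bit.
rewrite (_ : [set r | _] = ~` [set r : R | bit (val j).2 r]).
  by apply: measurableC; apply: measurable_bit.
by apply/seteqP; split=> r /= => [->|/negP/negbTE].
Qed.

Lemma bits_event_union (J : {fset I}) (phi : (I -> bool) -> bool) : depends_on J phi ->
  [set x : Om | phi (bits_of x)] = [set x : Om | exists c : {ffun J -> bool},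
     (if phi (ext false c) then [set x : Om | forall j : J, bits_of x (val j) = c j] else set0) x].
Proof.
move=> dphi; apply/seteqP; split=> x /=.
  move=> h; exists [ffun j => bits_of x (val j)].
  rewrite (dphi _ (bits_of x)); first by rewrite h => j; rewrite ffunE.
  by move=> i iJ; rewrite -[i]/(val [` iJ]%fset) ext_val ffunE.
move=> [c]; case: ifP => // pc /= h.
suff <- : phi (ext false c) = phi (bits_of x) by [].
by apply: dphi => i iJ; rewrite -[i]/(val [` iJ]%fset) ext_val h.
Qed.

Lemma measurable_bits_event (J : {fset I}) (phi : (I -> bool) -> bool) : depends_on J phi ->
  measurable [set x : Om | phi (bits_of x)].
Proof.
move=> dphi; rewrite (bits_event_union dphi).
rewrite (_ : [set x | _] = \bigcup_(c in [set: {ffun J -> bool}])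
  (if phi (ext false c) then [set x : Om | forall j : J, bits_of x (val j) = c j] else set0)); last first.
  by apply/seteqP; split=> x /= [c]; [move=> h|move=> _ h]; exists c.
apply: fin_bigcup_measurable => // c _; case: ifP => // _; exact: measurable_pattern.
Qed.

Variable mu : probability Om R.
Hypothesis iid : iid_uniform mu.

Lemma prob_rectangle (s : seq G) (m : nat) (c : I -> bool) : uniq s ->
  mu [set x | forall g, g \in s -> forall j, (j < m)%N -> bits_of x (g, j) = c (g, j)] =
  ((2^-1 ^+ m) ^+ size s)%:E.
Proof.
move=> us.
rewrite (iid (B := fun g => [set r : R | forall j, (j < m)%N -> bit j r = c (g, j)]) us); last first.
  by move=> g; apply: (@measurable_bits R m (fun j => c (g, j))).
rewrite (eq_bigr (fun=> (2^-1 ^+ m)%:E)) => [|g _]; last first.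
  exact: (@lebesgue_bits R m (fun j => c (g, j))).
by rewrite prodEFin big_const_seq count_predT iter_mulr_1.
Qed.

Lemma prob_bits_event (J : {fset I}) (phi : (I -> bool) -> bool) : depends_on J phi ->
  mu [set x | phi (bits_of x)] = (expect false J (fun y => (phi y)%:R))%:E.
Proof.
move=> dJ.
(* [J] is enlarged to a rectangle, finitely many group elements times the first [m] digits, because
   [iid_uniform] prescribes the law one coordinate at a time. *)
pose s := undup [seq i.1 | i <- enum_fset J].
have [m Jm] : exists m, forall i, i \in J -> (i.2 < m)%N.
  exists (\max_(i <- enum_fset J) i.2).+1 => i iJ; rewrite ltnS.
  exact: (@leq_bigmax_seq _ (enum_fset J) xpredT (fun i => i.2) i).
pose Q : {fset I} := [fset p in [seq (g, j) | g <- s, j <- iota 0 m]]%fset.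
have QE g j : ((g, j) \in Q) = (g \in s) && (j < m)%N.
  rewrite inE; apply/allpairsP/andP => [[[g' j'] /= [gs + [-> ->]]]|[gs jm]].
    by rewrite mem_iota add0n.
  by exists (g, j); split=> //; rewrite mem_iota add0n jm.
have JQ : (J `<=` Q)%fset.
  apply/fsubsetP => [[g j] ij]; rewrite QE mem_undup; apply/andP; split.
    by apply/mapP; exists (g, j).
  exact: (Jm (g, j)).
have dQ psi : depends_on J psi -> depends_on Q psi.
  by move=> dpsi y y' h; apply: dpsi => i iJ; apply: h; apply: (fsubsetP JQ).
rewrite -(@expect_sub R I bool false J Q _ _ JQ); last by move=> y y' h; rewrite (dJ _ _ h).
pose q : R := (2^-1 ^+ m) ^+ size s.
have pat (c : {ffun Q -> bool}) : mu [set x | forall j : Q, bits_of x (val j) = c j] = q%:E.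
  rewrite -(prob_rectangle m (ext false c) (undup_uniq _)); congr (mu _).
  apply/seteqP; split=> x /= h.
    move=> g gs j jm; have gjQ : (g, j) \in Q by rewrite QE gs jm.
    by rewrite -[(g, j)]/(val [` gjQ]%fset) ext_val h.
  move=> [[g j] gjQ]; rewrite -(ext_val false) /=; move: (gjQ); rewrite QE => /andP[gs jm].
  exact: h.
have main (psi : (I -> bool) -> bool) : depends_on Q psi -> mu [set x | psi (bits_of x)] =
    (q * \sum_(c : {ffun Q -> bool}) (psi (ext false c))%:R)%:E.
  move=> dpsi; rewrite (bits_event_union dpsi) measure_finite_union; first last.
  - move=> c c' x; case: ifP => // _; case: ifP => // _ /= h h'.
    by apply/ffunP => j; rewrite -h -h'.
  - by move=> c; case: ifP => // _; apply: measurable_pattern.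
  rewrite mulr_sumr -sumEFin; apply: eq_bigr => c _.
  by case: ifP => _; rewrite ?measure0 ?mulr0 // mulr1; exact: pat.
(* The sure event determines the product of [q] with the number of configurations, without counting
   [Q]. *)
have q1 : q * #|{ffun Q -> bool}|%:R = 1.
  have /(_ (fun=> true)) := main; rewrite sumr_const => /(_ (fun _ _ _ => erefl)).
  rewrite (_ : [set x | _] = setT); last by apply/seteqP; split.
  by rewrite probability_setT => -[].
rewrite main; last exact: dQ.
congr EFin; rewrite /expect; congr (_ * _).
apply: (mulIf (x := #|{ffun Q -> bool}|%:R)).
  by rewrite gt_eqF // card_configs_gt0 //; exact: false.
by rewrite q1 mulVf // gt_eqF // card_configs_gt0 //; exact: false.
Qed.

End BernoulliBits.

(** * Invariance of the Bernoulli measure *)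

Section Invariance.
Local Open Scope classical_set_scope.
Variables (R : realType) (G : countGroupType).
Local Notation gmul := (@monoid.mul G).
Local Notation ginv := (@monoid.inv G).
Local Notation Om := (bshift_space R G).

Definition boxes : set (set Om) := [set A | exists (s : seq G) (B : G -> set R),
  [/\ uniq s, forall g, measurable (B g) & A = [set x | forall g, g \in s -> B g (x g)]]].

Lemma boxes_setI : setI_closed boxes.
Proof.
move=> _ _ [s [B [us mB ->]]] [s' [B' [us' mB' ->]]].
exists (undup (s ++ s')); exists (fun g => (if g \in s then B g else setT) `&`
  (if g \in s' then B' g else setT)); split; first exact: undup_uniq.
  by move=> g; apply: measurableI; case: ifP.
apply/seteqP; split=> x /=.
  by move=> [h h'] g _; split; case: ifP => // gs; [apply: h|apply: h'].
by move=> h; split=> g gs; have := h g; rewrite mem_undup mem_cat gs ?orbT => /(_ isT) [].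
Qed.

Lemma measurable_box A : boxes A -> measurable A.
Proof.
move=> [s [B [us mB ->]]].
rewrite (_ : [set x | _] = \bigcap_(g in [set` s]) [set x : Om | B g (x g)]) //.
by apply: fin_bigcap_measurable => // g _; apply: measurable_coord.
Qed.

Lemma measurable_boxes : @measurable _ Om = <<s boxes >>.
Proof.
apply/seteqP; split; apply: smallest_sub.
- exact: smallest_sigma_algebra.
- move=> A [g [B [mB ->]]]; apply: sub_sigma_algebra.
  exists [:: g], (fun=> B); split=> //.
  by apply/seteqP; split=> x /= h; [move=> g'; rewrite inE => /eqP ->|apply: h; rewrite inE].
- exact: sigma_algebra_measurable.
- exact: measurable_box.
Qed.

Lemma measurable_bshift (g : G) : measurable_fun setT (@bshift R G g : Om -> Om).
Proof.
apply: (@measurability _ _ Om Om setT (@bshift R G g) boxes measurable_boxes).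
move=> _ [_ [s [B [us mB ->]]] <-]; rewrite setTI.
rewrite (_ : _ @^-1` _ = \bigcap_(h in [set` s]) [set x : Om | B h (x (gmul (ginv g) h))]) //.
by apply: fin_bigcap_measurable => // h _; apply: measurable_coord.
Qed.

(** Translation permutes the iid coordinates, so both measures agree on boxes, a pi-system
    generating the sigma-algebra. *)
Lemma bshift_invariant (mu : probability Om R) (g : G) (A : set Om) :
  iid_uniform mu -> measurable A -> mu (@bshift R G g @^-1` A) = mu A.
Proof.
move=> iid mA; pose f : {mfun Om >-> Om} := mfun_Sub (mem_set (measurable_bshift g)).
apply/esym; rewrite -[RHS]/(distribution mu f A).
apply: (measure_unique boxes (fun=> setT) measurable_boxes boxes_setI) => //.
- by move=> _; exists [::], (fun=> setT); split=> //; apply/seteqP; split.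
- by apply/seteqP; split=> // x _; exists 0%N.
- move=> _ [s [B [us mB ->]]]; rewrite /distribution /pushforward /=.
  rewrite (iid s B) //.
  have us' : uniq [seq gmul (ginv g) h | h <- s] by rewrite map_inj_uniq //; apply: mulgI.
  have := iid _ (fun h => B (gmul g h)) us' (fun h => mB _).
  rewrite big_map => e.
  have -> : (\prod_(h <- s) lebesgue_measure (B h `&` `[0%R, 1%R]))%E =
      (\prod_(h <- s) lebesgue_measure (B (gmul g (gmul (ginv g) h)) `&` `[0%R, 1%R]))%E.
    by apply: eq_bigr => h _; rewrite mulVKg.
  rewrite -e; congr (mu _); apply/seteqP; split=> x /= hx h.
    by move=> hs; have := hx (gmul (ginv g) h) (map_f _ hs); rewrite mulVKg.
  by move=> /mapP[h' hs ->]; rewrite mulVKg; apply: hx.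
by move=> _ /=; rewrite probability_setT ltry.
Qed.

End Invariance.

(** * Approximation of events by finitely many digits *)

Section Approximation.
Local Open Scope classical_set_scope.
Variables (R : realType) (G : countGroupType).
Local Notation I := (G * nat)%type.
Local Notation Om := (bshift_space R G).
Variable mu : probability Om R.
Hypothesis iid : iid_uniform mu.

Definition approximable (A : set Om) : Prop :=
  measurable A /\ forall e : R, 0 < e -> exists (K : {fset I}) (u : (I -> bool) -> bool),
    depends_on K u /\ (mu (A `+` [set x | u (bits_of x)]) <= e%:E)%E.

Lemma measurable_setY (A B : set Om) : measurable A -> measurable B -> measurable (A `+` B).
Proof. by move=> mA mB; apply: measurableU; apply: measurableD. Qed.

Lemma measure_cover2 (A B C : set Om) : measurable A -> measurable B -> measurable C ->
  A `<=` B `|` C -> (mu A <= mu B + mu C)%E.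
Proof.
move=> mA mB mC ABC; apply: le_trans (measureU2 mu mB mC).
by apply: le_measure => //; apply: mem_set => //; apply: measurableU.
Qed.

Lemma approximable_close (A : set Om) : measurable A ->
  (forall e : R, 0 < e -> exists2 B, approximable B & (mu (A `+` B) <= e%:E)%E) ->
  approximable A.
Proof.
move=> mA h; split=> // e e0; have e2 : 0 < e / 2 by rewrite divr_gt0.
have [B [mB aB] AB] := h _ e2; have [K [u [du Bu]]] := aB _ e2.
have mu' := measurable_bits_event du.
exists K, u; split=> //; rewrite [e]splitr EFinD.
apply: le_trans (leeD AB Bu); apply: measure_cover2; try exact: measurable_setY.
move=> x /= [[Ax ux]|[ux Ax]].
  by have [Bx|Bx] := pselect (B x); [right; left|left; left].
by have [Bx|Bx] := pselect (B x); [left; right|right; right].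
Qed.

Lemma approximable0 : approximable set0.
Proof.
split=> // e e0; exists fset0, (fun=> false); split=> //.
rewrite (_ : _ `+` _ = set0) ?measure0 ?lee_fin ?ltW //.
by apply/seteqP; split=> x //= [[]//|[]//].
Qed.

Lemma approximableC A : approximable A -> approximable (~` A).
Proof.
move=> [mA aA]; split; first exact: measurableC.
move=> e /aA [K [u [du Au]]]; exists K, (fun y => ~~ u y); split.
  by move=> y y' h; rewrite (du _ _ h).
rewrite (_ : _ `+` _ = A `+` [set x | u (bits_of x)]) //.
apply/seteqP; split=> x /=.
  by move=> [[Ax /negP]|[/negP ux]]; [rewrite negbK; right|move/contrapT; left].
move=> [[Ax /negP ux]|[ux Ax]]; first by right; split=> // nA; apply: nA.
by left; split=> //; rewrite ux.
Qed.

Lemma approximableU A B : approximable A -> approximable B -> approximable (A `|` B).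
Proof.
move=> [mA aA] [mB aB]; split; first exact: measurableU.
move=> e e0; have e2 : 0 < e / 2 by rewrite divr_gt0.
have [K [u [du Au]]] := aA _ e2; have [L [v [dv Bv]]] := aB _ e2.
have mu' := measurable_bits_event du; have mv' := measurable_bits_event dv.
have duv : depends_on (K `|` L)%fset (fun y => u y || v y).
  move=> y y' h; rewrite (du y y') ?(dv y y') // => i iK; apply: h; rewrite inE iK ?orbT //.
exists (K `|` L)%fset, (fun y => u y || v y); split=> //.
have muv := measurable_bits_event duv.
rewrite [e]splitr EFinD; apply: le_trans (leeD Au Bv).
apply: measure_cover2; try exact: measurable_setY.
  by apply: measurable_setY => //; apply: measurableU.
move=> x /= [[[Ax|Bx] /negP]|[/orP[ux|vx] /not_orP[Ax Bx]]].
- by rewrite negb_or => /andP[/negP ux _]; left; left.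
- by rewrite negb_or => /andP[_ /negP vx]; right; left.
- by left; right.
- by right; right.
Qed.

Lemma approximable_bigcup (A : (set Om)^nat) :
  (forall n, approximable (A n)) -> approximable (\bigcup_n A n).
Proof.
move=> aA; have mA n : measurable (A n) by case: (aA n).
have mU : measurable (\bigcup_n A n) by apply: bigcupT_measurable.
apply: approximable_close => // e e0.
pose B n := \big[setU/set0]_(i < n.+1) A i.
have aB n : approximable (B n).
  elim: n => [|n IH]; first by rewrite /B big_ord1.
  by rewrite /B big_ord_recr /=; apply: approximableU.
have mB n : measurable (B n) by case: (aB n).
have BU : \bigcup_n B n = \bigcup_n A n by rewrite bigcup_bigsetU_bigcup.
have ndB : nondecreasing_seq B.
  move=> m n mn; apply/subsetPset; apply: subset_bigsetU => //.
have := @nondecreasing_cvg_mu _ Om R mu B mB _ ndB; rewrite BU => /(_ mU) cv.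
have fU : mu (\bigcup_n A n) \is a fin_num by apply: fin_num_measure.
have [n Bn] : exists n, (mu (\bigcup_n A n) - e%:E < mu (B n))%E.
  have lt : (mu (\bigcup_n A n) - e%:E < mu (\bigcup_n A n))%E by rewrite lteBlDr // lteDl // lte_fin.
  move: lt; set c := (_ - _)%E => lt.
  apply: contrapT => /forallNP h; move: lt; apply/negP; rewrite -leNgt -(cvg_lim _ cv) //.
  apply: lime_le; first by apply/cvg_ex; exists (mu (\bigcup_n A n)).
  by apply: nearW => n; rewrite leNgt; apply/negP => hn; apply: (h n).
exists (B n); first exact: aB.
have sub : B n `<=` \bigcup_n A n by rewrite -BU; apply: bigcup_sup.
rewrite (_ : _ `+` _ = (\bigcup_n A n) `\` B n).
  rewrite measureD ?(setIidr sub) //; last by rewrite ltey_eq fU.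
  rewrite leeBlDr ?fin_num_measure // addeC -leeBlDr //; exact: ltW.
by rewrite /setY (_ : B n `\` _ = set0) ?setU0 // setD_eq0.
Qed.

Lemma prob_coord (g : G) (B : set R) : measurable B ->
  mu [set x | B (x g)] = lebesgue_measure (B `&` `[0, 1]).
Proof.
move=> mB; have := iid (s := [:: g]) (B := fun=> B) isT (fun=> mB).
rewrite big_seq1 => <-; congr (mu _); apply/seteqP; split=> x /= h.
  by move=> g'; rewrite inE => /eqP ->.
by apply: h; rewrite inE.
Qed.

Lemma approximable_ray (g : G) (a : R) : approximable [set x | `]-oo, a[ (x g)].
Proof.
have mray : measurable [set x : Om | `]-oo, a[ (x g)] by apply: measurable_coord.
split=> // e e0.
have [m me] : exists m, 2^-1 ^+ m <= e :> R.
  have h2 : `|2^-1 : R| < 1 by rewrite ger0_norm // invf_lt1 // ltr1n.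
  have /cvgrPdist_le/(_ e e0)[m _ /(_ m (leqnn m))] := cvg_expr h2.
  by rewrite sub0r normrN ger0_norm ?exprn_ge0 // => ?; exists m.
pose K : {fset I} := [fset (g, j) | j in iota 0 m]%fset.
pose u (y : I -> bool) : bool := (dyadic (fun j => y (g, j)) m)%:R < 2 ^+ m * a.
have p0 : 0 < 2 ^+ m :> R by rewrite exprn_gt0.
have du : depends_on K u.
  move=> y y' h; rewrite /u; congr (_%:R < _).
  have : forall k, (k <= m)%N -> dyadic (fun j => y (g, j)) k = dyadic (fun j => y' (g, j)) k.
    elim=> // k IH km /=; rewrite IH ?(ltnW km) // h //.
    by apply/imfsetP; exists k => //=; rewrite mem_iota.
  exact.
exists K, u; split=> //.
(* Rounding down to [m] digits can only put a point of [[a, a + 2^-m[] on the wrong side of [a].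
   Labels outside [[0, 1[] are discarded because [dyadic_bits] fails there; they form a null
   event. *)
pose C : set R := `[a, a + 2^-1 ^+ m[ `|` ~` `[0, 1[.
have mC : measurable C by apply: measurableU => //; apply: measurableC.
apply: (@le_trans _ _ (mu [set x | C (x g)])).
  apply: le_measure; [apply: mem_set|apply: mem_set|].
  - by apply: measurable_setY => //; apply: measurable_bits_event du.
  - exact: measurable_coord.
  move=> x /= h; have [r01|] := pselect (`[0, 1[ (x g)); last by right.
  left; move: r01 h; rewrite /= !in_itv /= => r01.
  have r0 : 0 <= 2 ^+ m * x g by rewrite mulr_ge0 ?(ltW p0) //; case/andP: r01.
  rewrite /u (_ : (fun j => bits_of x (g, j)) = (fun j => bit j (x g))) // dyadic_bits //.
  have /andP[t1 t2] := Num.Theory.truncn_itv r0.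
  move: t1 t2; set t := Num.truncn _; rewrite -natr1 => t1 t2.
  move=> [[xa /negP]|[xa /negP]].
    by rewrite -leNgt => ta; move: (le_trans ta t1); rewrite ler_pM2l // leNgt xa.
  rewrite -leNgt => ax; rewrite ax /= -(ltr_pM2l p0) mulrDr -exprMn mulfV // expr1n.
  lra.
rewrite prob_coord //.
have -> : C `&` `[0, 1] = (`[a, a + 2^-1 ^+ m[ `&` `[0, 1]) `|` (~` `[0, 1[ `&` `[0, 1]).
  by rewrite /C setIUl.
rewrite measureU0 //; first last.
- apply: (subset_measure0 _ _ _ (lebesgue_measure_set1 1)) => //.
    by apply: measurableI => //; apply: measurableC.
  move=> r [/= h]; rewrite in_itv /= => /andP[r0 r1]; apply/eqP.
  rewrite eq_le r1 /= leNgt; apply/negP => r1'; apply: h.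
  by rewrite in_itv /= r0.
- by apply: measurableI => //; apply: measurableC.
- exact: measurableI.
apply: (@le_trans _ _ (lebesgue_measure (`[a, a + 2^-1 ^+ m[ : set R))).
  by apply: le_measure; [apply: mem_set; apply: measurableI|apply: mem_set|apply: subIsetl].
rewrite [leLHS](lebesgue_measure_itv _) /= lte_fin; case: ifP => _; last by rewrite lee_fin ltW.
by rewrite -EFinB lee_fin addrAC subrr add0r.
Qed.

Lemma approximable_coord (g : G) (B : set R) : measurable B -> approximable [set x | B (x g)].
Proof.
move=> mB; have : <<s @measurable_realfun.RGenInftyO.G R >> B.
  by move: mB; rewrite -[@measurable _ R B]/((@ocitv R).-sigma.-measurable B)
    measurable_realfun.RGenInftyO.measurableE.
suff h : <<s @measurable_realfun.RGenInftyO.G R >> `<=`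
    [set B | approximable [set x : Om | B (x g)]] by apply: h.
apply: smallest_sub; last by move=> _ [a ->]; apply: approximable_ray.
split=> [|A aA|A aA] /=; first exact: approximable0.
  rewrite (_ : [set x | _] = ~` [set x : Om | A (x g)]); first exact: approximableC.
  by apply/seteqP; split=> x /= => [[]|].
rewrite (_ : [set x | _] = \bigcup_n [set x : Om | A n (x g)]) //.
exact: approximable_bigcup.
Qed.

Lemma measurable_approximable (A : set Om) : measurable A -> approximable A.
Proof.
move: A; apply: smallest_sub; last by move=> _ [g [B [mB ->]]]; apply: approximable_coord.
split=> [|A aA|A aA]; first exact: approximable0.
  by rewrite setTD; apply: approximableC.
exact: approximable_bigcup.
Qed.

End Approximation.

(** * Approximation of the factors and weak convergence *)

Section FactorApprox.
Local Open Scope classical_set_scope.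
Variables (R : realType) (G : countGroupType).
Local Notation ginv := (@monoid.inv G).
Local Notation Om := (bshift_space R G).
Variable mu : probability Om R.
Hypothesis iid : iid_uniform mu.

Local Notation m A := (fine (mu A)).

Lemma fineK_mu A : measurable A -> (m A)%:E = mu A.
Proof. by move=> mA; rewrite fineK // fin_num_measure. Qed.

Lemma le_fine_mu A B : measurable A -> measurable B -> A `<=` B -> m A <= m B.
Proof.
move=> mA mB AB; rewrite -lee_fin !fineK_mu //.
by apply: le_measure => //; apply: mem_set.
Qed.

Lemma fine_mu_setY A B : measurable A -> measurable B -> `|m A - m B| <= m (A `+` B).
Proof.
move=> mA mB; have mY := measurable_setY mA mB.
have cover (C D : set Om) : measurable C -> measurable D -> C `<=` D `|` (A `+` B) ->
    m C <= m D + m (A `+` B).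
  move=> mC mD CD; rewrite -lee_fin EFinD !fineK_mu //.
  exact: measure_cover2.
have h1 : m A <= m B + m (A `+` B).
  apply: cover => // x Ax; have [Bx|Bx] := pselect (B x); first by left.
  by right; left.
have h2 : m B <= m A + m (A `+` B).
  apply: cover => // x Bx; have [Ax|Ax] := pselect (A x); first by left.
  by right; right.
by rewrite ler_norml; apply/andP; split; lra.
Qed.

Lemma fine_mu_seq_cover (S : seq G) (F : G -> set Om) (e : R) :
  (forall g, measurable (F g)) -> (forall g, m (F g) <= e) ->
  measurable [set x | exists2 g, g \in S & F g x] /\
  m [set x | exists2 g, g \in S & F g x] <= (size S)%:R * e.
Proof.
move=> mF Fe; elim: S => [|g S [mS IH]].
  rewrite (_ : [set x | _] = set0); first by rewrite measure0 mul0r.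
  by apply/seteqP; split=> x //= [].
rewrite (_ : [set x | exists2 g0, g0 \in g :: S & _] =
    F g `|` [set x | exists2 g, g \in S & F g x]); last first.
  apply/seteqP; split=> x /=.
    by move=> [c']; rewrite inE => /orP[/eqP ->|c's] Fx; [left|right; exists c'].
  move=> [Fx|[c' c's Fx]]; [exists g|exists c'] => //; rewrite inE ?eqxx //.
  by rewrite c's orbT.
split; first exact: measurableU.
have : m (F g `|` [set x | exists2 g, g \in S & F g x]) <=
    m (F g) + m [set x | exists2 g, g \in S & F g x].
  have mU : measurable (F g `|` [set x | exists2 g, g \in S & F g x]) by apply: measurableU.
  by rewrite -lee_fin EFinD !fineK_mu //; apply: measure_cover2.
move=> h; apply: le_trans h _; rewrite /= -natr1 mulrDl mul1r addrC lerD //.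
Qed.

Lemma measurable_pattern_set (S : seq G) (E0 : G -> bool) :
  measurable (pattern S E0 : set (subsetsM G)).
Proof.
rewrite (_ : pattern S E0 = \bigcap_(g in [set` S]) [set E : subsetsM G | E g = E0 g]) //.
apply: fin_bigcap_measurable => // g _.
have mg : measurable [set E : subsetsM G | E g] by apply: sub_sigma_algebra; exists g.
case: (E0 g) => //.
rewrite (_ : [set E | _] = ~` [set E : subsetsM G | E g]); first exact: measurableC.
by apply/seteqP; split=> E /= => [->|/negP/negbTE].
Qed.

Lemma factor_approx (S : seq G) (eta : R) : 0 < eta ->
  exists2 p0 : R, 0 < p0 &
  forall (U : set Om) (nu : probability (subsetsM G) R), measurable U -> 0 < m U <= p0 ->
    is_F (@bshift R G) mu U nu ->
  exists P : probability (subsetsM G) R, [/\ unimodular P, finitely_supported P &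
    forall E0 : G -> bool, `|fine (P (pattern S E0)) - fine (nu (pattern S E0))| <= eta].
Proof.
move=> eta0; pose e : R := Num.min (eta / 2) 1.
have e0 : 0 < e by rewrite lt_min divr_gt0 //=.
have e1 : e <= 1 by rewrite ge_min lexx orbT.
have ee : e <= eta / 2 by rewrite ge_min lexx.
have [p0 p00 H] := @cluster_approx R G S e e0 e1.
(* Passing to the approximating event below raises the probability by at most one half of itself, so
   it stays under [p0]. *)
exists (p0 / 2); first by rewrite divr_gt0.
move=> U nu mU /andP[]; set p' := m U => p'0 p'p0 FU.
(* The tolerance [de] is proportional to [p'], since everything is finally divided by [p']. It is
   spent once on [U], once for each translate by [S] and once on replacing [p'] by [p]:
   [(size S).+2] times in all. *)
pose s2 : R := (size S).+2%:R; have s20 : 0 < s2 by rewrite ltr0n.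
have s22 : 2 <= s2 by rewrite ler_nat.
pose de : R := p' * e / s2.
have de0 : 0 < de by rewrite divr_gt0 // mulr_gt0.
have deE : s2 * de = p' * e by rewrite mulrC divfK // gt_eqF.
have de2 : de <= p' / 2.
  rewrite /de -mulrA ler_wpM2l ?(ltW p'0) // ler_pdivrMr //.
  apply: (le_trans e1); rewrite mulrC ler_pdivlMr // mul1r; exact: s22.
have [_ aU] := measurable_approximable iid mU.
have [K [u [du Uu]]] := aU _ de0.
pose U' := [set x : Om | u (bits_of x)].
have mU' : measurable U' by apply: measurable_bits_event du.
have mY := measurable_setY mU mU'.
have Yde : m (U `+` U') <= de by rewrite -lee_fin fineK_mu.
have pE : m U' = prob_ev R K u by rewrite /U' (prob_bits_event iid du).
set p := prob_ev R K u in pE.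
have pp' : `|p' - p| <= de by rewrite -pE; apply: le_trans (fine_mu_setY mU mU') Yde.
have /andP[pp'1 pp'2] : - de <= p' - p <= de by rewrite -ler_norml.
have p_gt0 : 0 < p by lra.
have pp0 : 0 < p <= p0 by rewrite p_gt0; lra.
pose J := (K `|` [fset gact g i | g in S, i in K])%fset.
have KJ : (K `<=` J)%fset by rewrite fsubsetUl.
have SJ : {in S, forall g, {in K, forall i, gact g i \in J}}.
  move=> g gS i iK; rewrite inE; apply/orP; right; apply/imfset2P.
  by exists g => //; exists i.
have [P [PU PF PE]] := H K J u du KJ SJ pp0.
exists P; split=> // E0; have := PE E0.
have dH : depends_on J (hit_pattern S E0 u).
  move=> y y' h; rewrite /hit_pattern (du y y' (fun i iK => h i (fsubsetP KJ i iK))).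
  congr (_ && _); apply: eq_in_all => g gS.
  by rewrite (du (shift g y) (shift g y') (fun i iK => h _ (SJ g gS i iK))).
pose V' := [set x : Om | hit_pattern S E0 u (bits_of x)].
have mV' : measurable V' by apply: measurable_bits_event dH.
have -> : expect false J (fun y => (hit_pattern S E0 u y)%:R) = m V'.
  by rewrite /V' (prob_bits_event iid dH).
pose V := U `&` iotaU (@bshift R G) U @^-1` pattern S E0.
have mbs g A : measurable A -> measurable (@bshift R G g @^-1` A).
  by move=> mA; rewrite -[X in measurable X]setTI; apply: measurable_bshift.
have mV : measurable V.
  apply: measurableI => //.
  rewrite (_ : _ @^-1` _ = \bigcap_(g in [set` S])
    [set x : Om | `[< (@bshift R G (ginv g) @^-1` U) x >] = E0 g]) //.
  apply: fin_bigcap_measurable => // g _.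
  case: (E0 g).
    rewrite (_ : [set x | _] = @bshift R G (ginv g) @^-1` U); first exact: mbs.
    by apply/seteqP; split=> x /= => [/asboolP|/asboolP].
  rewrite (_ : [set x | _] = ~` (@bshift R G (ginv g) @^-1` U)).
    by apply: measurableC; apply: mbs.
  by apply/seteqP; split=> x /= => [h Ux|/asboolF//]; move: h; rewrite asboolT.
have FV : p' * fine (nu (pattern S E0)) = m V.
  have := FU _ (measurable_pattern_set S E0); rewrite -/V -(fineK_mu mU) -(fineK_mu mV).
  have /fineK <- : nu (pattern S E0) \is a fin_num.
    by apply: fin_num_measure; apply: measurable_pattern_set.
  by rewrite -EFinM => -[].
(* Off [U + U'] (symmetric difference) and its translates [F g], both events show the same pattern
   on [S]; by invariance each translate is as small as the original. *)
pose F g := @bshift R G (ginv g) @^-1` (U `+` U').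
have Fde g : m (F g) <= de.
  by rewrite /F (bshift_invariant _ iid mY).
have [mFS FS] := @fine_mu_seq_cover S F de (fun g => mbs _ _ mY) Fde.
set W := [set x | _] in mFS FS.
have VV' : `|m V - m V'| <= (size S).+1%:R * de.
  apply: le_trans (fine_mu_setY mV mV') _.
  have mYW : measurable ((U `+` U') `|` W) by apply: measurableU.
  apply: (@le_trans _ _ (m ((U `+` U') `|` W))).
    apply: le_fine_mu; [exact: measurable_setY|exact: mYW|].
    move=> x VVx; apply: contrapT => /not_orP[nY nW].
    have UU' : U x <-> U' x.
      by split=> h; apply: contrapT => h'; apply: nY; [left|right].
    have gU g : g \in S -> `[< U (bshift (ginv g) x) >] = u (shift g (bits_of x)).
      move=> gS; rewrite shift_bits_of.
      have nY' : ~ (U `+` U') (bshift (ginv g) x).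
        by move=> h; apply: nW; exists g.
      apply/asboolP/idP => h; apply: contrapT => h'; apply: nY'; [left|right] => //.
    have same : V x <-> V' x.
      rewrite /V /V' /hit_pattern /=; split.
        move=> [Ux px]; apply/andP; split; first exact/UU'.
        by apply/allP => g gS; rewrite -gU //; apply/eqP; apply: px.
      move=> /andP[ux /allP px]; split; first exact/UU'.
      by move=> g gS; rewrite /iotaU gU //; apply/eqP; apply: px.
    by case: VVx => -[] h h'; apply: h'; apply/same.
  rewrite -natr1 mulrDl mul1r addrC.
  have : m ((U `+` U') `|` W) <= m (U `+` U') + m W.
    by rewrite -lee_fin EFinD !fineK_mu //; apply: measure_cover2.
  move=> h; apply: le_trans h _; exact: lerD.
have V'p : 0 <= m V' / p <= 1.
  rewrite divr_ge0 ?fine_ge0 ?(ltW p_gt0) //= ler_pdivrMr // mul1r -pE.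
  apply: le_fine_mu => // x /=; by rewrite /hit_pattern => /andP[].
have -> : fine (nu (pattern S E0)) = m V / p' by rewrite -FV mulrAC divff ?mul1r // gt_eqF.
move=> h1; set b := fine (P _) in h1 *.
have h2 : `|m V' / p - m V / p'| <= e.
  have -> : m V' / p - m V / p' = (m V' / p * (p' - p) - (m V - m V')) / p'.
    by field; rewrite !gt_eqF.
  rewrite normrM (gtr0_norm (x := p'^-1)) ?invr_gt0 // ler_pdivrMr // [e * _]mulrC -deE.
  apply: le_trans (ler_normB _ _) _.
  rewrite /s2 -natr1 mulrDl mul1r addrC; apply: lerD => //.
  case/andP: V'p => V'p0 V'p1.
  rewrite normrM ger0_norm // -[leRHS]mul1r; apply: ler_pM => //.
have -> : b - m V / p' = (b - m V' / p) + (m V' / p - m V / p') by lra.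
by apply: le_trans (ler_normD _ _) _; lra.
Qed.

End FactorApprox.

(** * Product topology and finite patterns *)

Section PatternTopology.
Local Open Scope classical_set_scope.
Variables (R : realType) (G : countGroupType).
Local Notation cantor := {ptws G -> bool}.

Definition agree_on (S : seq G) (E E' : G -> bool) := forall g, g \in S -> E' g = E g.

Lemma near_agree (S : seq G) (E : cantor) : \forall E' \near E, agree_on S E E'.
Proof.
have FE : Filter (nbhs E) by exact: nbhs_filter.
elim: S => [|g S IH]; first by apply: filterS filterT => E' _ g; rewrite in_nil.
have Eg : \forall E' \near E, (E' : G -> bool) g = E g.
  have pc := @proj_continuous G (fun=> bool : topologicalType) g E.
  apply: (pc [set b | b = (E : G -> bool) g]).
  by rewrite /= nbhs_principalE; apply/principal_filterP.
apply: filterS2 Eg IH => E' Eg ES h; rewrite inE => /orP[/eqP -> //|]; exact: ES.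
Qed.

Lemma nbhs_agree (E : cantor) (A : set cantor) : nbhs E A ->
  exists S : seq G, [set E' | agree_on S E E'] `<=` A.
Proof.
pose F : set_system cantor := fun A => exists S : seq G, [set E' | agree_on S E E'] `<=` A.
have FF : Filter F.
  split=> [|P Q [S SP] [T TQ]|P Q PQ [S SP]]; first by exists [::].
    by exists (S ++ T) => E' h; split; [apply: SP|apply: TQ] => g gS; apply: h;
      rewrite mem_cat gS ?orbT.
  by exists S; apply: subset_trans PQ.
(* The sets containing a cylinder around [E] form a filter; convergence of this filter to [E] can be
   tested one coordinate at a time. *)
suff : F --> E by apply.
apply/cvg_sup => g W /= [Q [[C oC <-] CE] QW].
exists [:: g] => E' h; apply: QW => /=; have -> : E' g = E g by apply: h; rewrite inE.
exact: CE.
Qed.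

Definition prefix_seq (n : nat) : seq G := pmap choice.unpickle (iota 0 n).

Lemma mem_prefix_seq (g : G) n : (choice.pickle g < n)%N -> g \in prefix_seq n.
Proof.
move=> gn; rewrite /prefix_seq mem_pmap; apply/mapP; exists (choice.pickle g); last by rewrite choice.pickleK.
by rewrite mem_iota.
Qed.

Lemma prefix_seq_sub (S : seq G) : exists n0, forall n, (n0 <= n)%N -> {subset S <= prefix_seq n}.
Proof.
exists (\max_(g <- S) (choice.pickle g)).+1 => n hn g gS; apply: mem_prefix_seq.
by apply: leq_trans hn; rewrite ltnS; apply: (@leq_bigmax_seq _ S xpredT choice.pickle g).
Qed.

(** Uniform continuity on a compact space, expressed by the finite prefixes of the enumeration of
    the group. *)
Lemma uniform_prefix (f : cantor -> R) (e : R) : continuous f -> 0 < e ->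
  exists n0, forall n, (n0 <= n)%N ->
    forall E E', agree_on (prefix_seq n) E E' -> `|f E - f E'| <= e.
Proof.
move=> cf e0.
have cpt : compact [set: cantor].
  have := @tychonoff G (fun=> bool : topologicalType) (fun=> setT) (fun=> bool_compact).
  by congr compact; apply/seteqP; split.
pose P n E := forall E', agree_on (prefix_seq n) E E' -> `|f E - f E'| <= e.
have e2 : 0 < e / 2 by rewrite divr_gt0.
have := (compact_near_coveringP _).1 cpt nat \oo P _; case.
  move=> E _; have /cvgrPdist_le/(_ _ e2)/nbhs_agree[S HS] := cf E.
  have [n0 hn0] := prefix_seq_sub S.
  exists ([set E' | agree_on S E E'], [set n | (n0 <= n)%N]).
    by split; [exact: near_agree|exists n0].
  move=> [E' n] /= [EE' hn] E'' E'E''.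
  have h1 := HS _ EE'.
  have h2 : agree_on S E E'' by move=> g gS; rewrite E'E'' ?EE' //; apply: hn0 hn _ gS.
  have := HS _ h2; move: h1 => /=; rewrite [ `|f E - f E'|]distrC => h1 h3.
  have -> : f E' - f E'' = (f E' - f E) + (f E - f E'') by lra.
  by apply: le_trans (ler_normD _ _) _; lra.
move=> n0 _ h; exists n0 => n hn E E' EE'; exact: (h n hn E I E' EE').
Qed.

Lemma pattern_indic_continuous (S : seq G) (E0 : G -> bool) :
  continuous (\1_(pattern S E0) : cantor -> R).
Proof.
move=> E; apply: cvg_near_cst; apply: filterS (near_agree S E) => E' EE'.
rewrite !indicE; congr (nat_of_bool _)%:R.
by apply/idP/idP => /set_mem h; apply/mem_set => g gS; have := h g gS; rewrite EE'.
Qed.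

End PatternTopology.

Section CylinderIntegral.
Local Open Scope classical_set_scope.
Variables (R : realType) (G : countGroupType).
Local Notation cantor := {ptws G -> bool}.

Definition prefix_set (n : nat) : {fset G} := [fset g in prefix_seq G n]%fset.
Definition trace (n : nat) (E : G -> bool) : {ffun prefix_set n -> bool} :=
  [ffun j => E (val j)].
Definition prefix_pattern (n : nat) (t : {ffun prefix_set n -> bool}) : set (subsetsM G) :=
  pattern (prefix_seq G n) (ext false t).

Lemma ext_trace n (E : G -> bool) : agree_on (prefix_seq G n) E (ext false (trace n E)).
Proof.
move=> g gS; have gJ : g \in prefix_set n by rewrite inE.
by rewrite -[g]/(val [` gJ]%fset) ext_val ffunE.
Qed.

Lemma prefix_patternE n t (E : subsetsM G) : (E \in prefix_pattern t) = (t == trace n E).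
Proof.
apply/idP/eqP => [/set_mem h|->].
  apply/ffunP => j; rewrite ffunE -(ext_val false) h //.
  by have := fsvalP j; rewrite inE.
by apply/mem_set => g gS; rewrite ext_trace.
Qed.

Definition cylinder_step (f : cantor -> R) (n : nat) (E : subsetsM G) : R :=
  \sum_(t : {ffun prefix_set n -> bool}) f (ext false t) * \1_(prefix_pattern t) E.

Lemma cylinder_stepE f n E : cylinder_step f n E = f (ext false (trace n E)).
Proof.
rewrite /cylinder_step (bigD1 (trace n E)) //= big1 ?addr0 => [|t tE].
  by rewrite indicE prefix_patternE eqxx mulr1.
by rewrite indicE prefix_patternE (negbTE tE) mulr0.
Qed.

Lemma measurable_prefix_pattern n t : measurable (@prefix_pattern n t).
Proof. exact: measurable_pattern_set. Qed.

Lemma measurable_cylinder_step f n : measurable_fun setT (cylinder_step f n).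
Proof.
apply: measurable_sum => t; apply: measurable_funM; first exact: measurable_cst.
by apply: measurable_indic; apply: measurable_prefix_pattern.
Qed.

Variable P : probability (subsetsM G) R.

Definition step_sum (f : cantor -> R) (n : nat) : R :=
  \sum_(t : {ffun prefix_set n -> bool}) f (ext false t) * fine (P (prefix_pattern t)).

Lemma integrable_step_term (f : cantor -> R) n (t : {ffun prefix_set n -> bool}) :
  P.-integrable setT (fun E => (f (ext false t))%:E * (\1_(prefix_pattern t) E)%:E)%E.
Proof. by apply: integrableZl => //; apply: integrable_indic => //; apply: measurable_prefix_pattern. Qed.

Lemma cylinder_step_EFin f n E : ((cylinder_step f n E)%:E =
  \sum_(t : {ffun prefix_set n -> bool}) (f (ext false t))%:E * (\1_(prefix_pattern t) E)%:E)%E.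
Proof. by rewrite /cylinder_step -sumEFin; apply: eq_bigr => t _; rewrite EFinM. Qed.

Lemma integral_cylinder_step f n : (\int[P]_E (cylinder_step f n E)%:E = (step_sum f n)%:E)%E.
Proof.
under eq_integral do rewrite cylinder_step_EFin.
rewrite integral_sum //; last by move=> t; apply: integrable_step_term.
rewrite /step_sum -sumEFin; apply: eq_bigr => t _.
have mp := measurable_prefix_pattern t.
rewrite integralZl //; last exact: integrable_indic.
by rewrite integral_indic // setIT EFinM fineK // fin_num_measure.
Qed.

Lemma integrable_cylinder_step f n : P.-integrable setT (EFin \o cylinder_step f n).
Proof.
rewrite (_ : _ \o _ = fun E => (\sum_(t : {ffun prefix_set n -> bool})
  (f (ext false t))%:E * (\1_(prefix_pattern t) E)%:E)%E).
  by apply: integrable_sum => // t _; apply: integrable_step_term.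
by apply/funext => E; rewrite /= cylinder_step_EFin.
Qed.

(** The sigma-algebra is given by cylinders, so measurability is obtained from a pointwise limit of
    functions of finitely many coordinates. *)
Lemma measurable_continuous (f : cantor -> R) : continuous f ->
  measurable_fun setT (f : subsetsM G -> R).
Proof.
move=> cf; apply: (@measurable_fun_cvg _ (subsetsM G) R setT (cylinder_step f)).
  by move=> n; apply: measurable_cylinder_step.
move=> E _; apply/cvgrPdist_le => e e0; have [n0 h] := uniform_prefix cf e0.
by exists n0 => // n hn; rewrite cylinder_stepE; apply: (h n hn); apply: ext_trace.
Qed.

Lemma integral_continuous_close (f : cantor -> R) n (e : R) : continuous f -> 0 <= e ->
  (forall E E', agree_on (prefix_seq G n) E E' -> `|f E - f E'| <= e) ->
  exists2 r : R, (\int[P]_E (f E)%:E = r%:E)%E & `|r - step_sum f n| <= e.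
Proof.
move=> cf e0 fe; have mf := measurable_continuous cf.
have dist (E : subsetsM G) : `|f E - cylinder_step f n E| <= e.
  by rewrite cylinder_stepE; apply: fe; apply: ext_trace.
pose M := \sum_(t : {ffun prefix_set n -> bool}) `|f (ext false t)| + e.
have fM (E : subsetsM G) : `|f E| <= M.
  have -> : f E = cylinder_step f n E + (f E - cylinder_step f n E) by lra.
  apply: le_trans (ler_normD _ _) _; apply: lerD => //.
  rewrite cylinder_stepE (bigD1 (trace n E)) //= lerDl; exact: sumr_ge0.
have M0 : 0 <= M by rewrite addr_ge0 // sumr_ge0.
have fint : P.-integrable setT (EFin \o (f : subsetsM G -> R)).
  apply: (@le_integrable _ _ _ P setT measurableT _ (EFin \o cst M)).
  - exact/measurable_EFinP.
  - by move=> E _; rewrite /= lee_fin (ger0_norm M0); apply: fM.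
  - exact: finite_measure_integrable_cst.
have sint := integrable_cylinder_step f n.
have fin := integrable_fin_num measurableT fint.
exists (fine (\int[P]_E (f E)%:E)%E); first by rewrite fineK.
have /esym := integralB_EFin measurableT fint sint.
rewrite integral_cylinder_step => h.
rewrite -lee_fin -abse_EFin EFinB fineK // h.
have mB : measurable_fun setT (fun E : subsetsM G => ((f E)%:E - (cylinder_step f n E)%:E)%E).
  apply/measurable_EFinP/measurable_funB => //; exact: measurable_cylinder_step.
apply: le_trans (le_abse_integral _ _ mB) _ => //.
apply: (@le_trans _ _ (\int[P]_(E in setT) (cst e%:E E))%E).
  apply: ge0_le_integral => //.
  - exact: measurableT_comp.
  - by move=> E _; rewrite lee_fin.
by rewrite (integral_cst _ measurableT) [X in (_ * X)%E](probability_setT P) mule1.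
Qed.

End CylinderIntegral.

Section Main.
Local Open Scope classical_set_scope.
Variables (R : realType) (G : countGroupType).

(** The tolerance is divided by the number of patterns, so summing over all of them leaves
    [M / n.+1]. The bound [M] on [f] exists because [f] stays within [1] of finitely many values. *)
Lemma weak_cvg_of_patterns (Pn : nat -> probability (subsetsM G) R)
    (P : probability (subsetsM G) R) :
  (forall n (t : {ffun prefix_set G n -> bool}),
    `|fine (Pn n (prefix_pattern t)) - fine (P (prefix_pattern t))| <=
    (n.+1%:R * #|{ffun prefix_set G n -> bool}|%:R)^-1) ->
  weak_cvg Pn P.
Proof.
move=> close f cf.
have [n1 h1] := uniform_prefix cf ltr01.
pose M := \sum_(t : {ffun prefix_set G n1 -> bool}) `|f (ext false t)| + 1.
have fM (E : {ptws G -> bool}) : `|f E| <= M.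
  have := h1 n1 (leqnn _) E _ (@ext_trace G n1 E).
  set E' : {ptws G -> bool} := ext false (trace n1 E) => d.
  have -> : f E = f E' + (f E - f E') by lra.
  apply: le_trans (ler_normD _ _) _; apply: lerD => //.
  by rewrite (bigD1 (trace n1 E)) //= lerDl; exact: sumr_ge0.
have M0 : 0 <= M by rewrite addr_ge0 // sumr_ge0.
have sums n : `|step_sum P f n - step_sum (Pn n) f n| <= M / n.+1%:R.
  rewrite /step_sum -sumrB; apply: le_trans (ler_norm_sum _ _ _) _.
  pose c : R := (n.+1%:R * #|{ffun prefix_set G n -> bool}|%:R)^-1.
  apply: (@le_trans _ _ (\sum_(t : {ffun prefix_set G n -> bool}) M * c)).
    apply: ler_sum => t _; rewrite -mulrBr normrM; apply: ler_pM => //.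
    by rewrite distrC.
  rewrite sumr_const -[_ *+ _]mulr_natr -mulrA /c invfM mulrVK ?mulfVK //.
  by rewrite unitfE gt_eqF // card_configs_gt0 //; exact: false.
have [r rE _] := integral_continuous_close P cf ler01 (h1 n1 (leqnn _)).
rewrite rE.
have rnE n : exists rn : R, (\int[Pn n]_E (f E)%:E = rn%:E)%E.
  by have [s sE _] := integral_continuous_close (Pn n) cf ler01 (h1 n1 (leqnn _)); exists s.
pose rn n := projT1 (cid (rnE n)).
have rnP n : (\int[Pn n]_E (f E)%:E = (rn n)%:E)%E by rewrite /rn; case: cid.
rewrite (_ : (fun n => _) = EFin \o rn); last by apply/funext => n; rewrite rnP.
apply: cvg_EFin; first by apply: nearW.
apply/cvgrPdist_le => e e0; have e3 : 0 < e / 3 by rewrite divr_gt0.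
have [n2 h2] := uniform_prefix cf e3.
pose n3 := Num.truncn (M / (e / 3)).
exists (maxn n2 n3) => // n /=; rewrite geq_max => /andP[n2n n3n].
have [r' r'E hr'] := integral_continuous_close P cf (ltW e3) (h2 n n2n).
have [s sE hs] := integral_continuous_close (Pn n) cf (ltW e3) (h2 n n2n).
have rr' : r = r' by move: r'E; rewrite rE => -[].
have rs : rn n = s by move: sE; rewrite rnP => -[].
have h3 : M / n.+1%:R <= e / 3.
  rewrite ler_pdivrMr ?ltr0n // mulrC -ler_pdivrMr //.
  apply: ltW; apply: lt_le_trans (truncnS_gt _) _.
  by rewrite ler_nat ltnS.
rewrite rr' rs; have := sums n.
have -> : r' - s = (r' - step_sum P f n) + (step_sum P f n - step_sum (Pn n) f n) +
  (step_sum (Pn n) f n - s) by lra.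
move=> h4; apply: le_trans (ler_normD _ _) _.
have := ler_normD (r' - step_sum P f n) (step_sum P f n - step_sum (Pn n) f n).
rewrite distrC in hs; move: hs hr' h4 h3.
set a := `|r' - _|; set b := `|_ - s|; set c := `|step_sum P f n - _|.
by set d := `|_ + _|; set q := M / _; lra.
Qed.

Lemma patterns_of_weak_cvg (Pn : nat -> probability (subsetsM G) R)
    (P : probability (subsetsM G) R) (S : seq G) (E0 : G -> bool) :
  weak_cvg Pn P -> fine (Pn n (pattern S E0)) @[n --> \oo] --> fine (P (pattern S E0)).
Proof.
move=> cv; have mp := measurable_pattern_set S E0.
have E (Q : probability (subsetsM G) R) :
    (\int[Q]_E (\1_(pattern S E0) E)%:E = (fine (Q (pattern S E0)))%:E)%E.
  by rewrite integral_indic // setIT fineK // fin_num_measure.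
have := cv _ (@pattern_indic_continuous R G S E0); rewrite E.
rewrite (_ : (fun n => _) = EFin \o (fun n => fine (Pn n (pattern S E0)))).
  by move/fine_cvg.
by apply/funext => n; rewrite E.
Qed.

End Main.

Theorem theorem1p5 (R : realType) (G : countGroupType)
    (nu : probability (subsetsM G) R) :
  fiid_thinning nu ->
  exists nun : nat -> probability (subsetsM G) R,
    (forall n, unimodular (nun n) /\ finitely_supported (nun n)) /\
    weak_cvg nun nu.
Proof.
move=> [mu [iid [U [Fn [UF [U0 Fnu]]]]]].
pose eta n : R := (n.+1%:R * #|{ffun prefix_set G n -> bool}|%:R)^-1.
have eta0 n : 0 < eta n.
  by rewrite invr_gt0 mulr_gt0 ?ltr0n // -(ltr0n R) card_configs_gt0 //; exact: false.
have step n : exists P : probability (subsetsM G) R,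
    [/\ unimodular P, finitely_supported P & forall t : {ffun prefix_set G n -> bool},
      `|fine (P (prefix_pattern t)) - fine (nu (prefix_pattern t))| <= eta n].
  have e2 : 0 < eta n / 2 by rewrite divr_gt0.
  have [p0 p00 H] := factor_approx iid (prefix_seq G n) e2.
  have near1 : (\forall k \near \oo, fine (mu (U k)) <= p0)%classic.
    have /fine_cvg/cvgrPdist_le/(_ _ p00) := U0.
    apply: filterS => k /=; rewrite sub0r normrN; apply: le_trans; exact: ler_norm.
  have near2 : (\forall k \near \oo, forall t : {ffun prefix_set G n -> bool},
      `|fine (nu (prefix_pattern t)) - fine (Fn k (prefix_pattern t))| <= eta n / 2)%classic.
    apply: filter_forall => t.
    by have /cvgrPdist_le/(_ _ e2) := @patterns_of_weak_cvg R G Fn nu (prefix_seq G n) (ext false t) Fnu.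
  (* A late [k] meets both demands: [U k] is rare enough for [factor_approx], and [Fn k] is already
     close to [nu] on the patterns of the prefix. Each takes half of [eta n]. *)
  have [k [k1 k2]] := filter_ex (filterI near1 near2).
  have [mU U_gt0 FU] := UF k.
  have Upos : 0 < fine (mu (U k)) <= p0.
    by rewrite k1 andbT -lte_fin fineK ?fin_num_measure.
  have [P [PU PF PE]] := H _ _ mU Upos FU.
  exists P; split=> // t.
  have := PE (ext false t); have := k2 t; rewrite -/(prefix_pattern t).
  set a := fine (nu _); set b := fine (Fn k _); set c := fine (P _) => ab cb.
  have -> : c - a = (c - b) + (b - a) by lra.
  apply: le_trans (ler_normD _ _) _; move: ab; rewrite distrC; lra.
exists (fun n => projT1 (cid (step n))); split=> [n|].
  by case: cid => P [].
by apply: weak_cvg_of_patterns => n t; case: cid => P [PU PF PE] /=; apply: PE.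
Qed.
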